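(* Let $F$ be the field of meromorphic functions on a complex domain $D$, let $n,s$ be positive integers and let $\mathcal{M}=\begin{pmatrix}\mathcal{A}&\mathcal{B}\\\mathcal{C}&\mathcal{D}\end{pmatrix}\in F^{(n+s)\times(n+s)}$ with $\mathcal{A}\in F^{n\times n}$, $\mathcal{B}\in F^{n\times s}$, $\mathcal{C}\in F^{s\times n}$, $\mathcal{D}\in F^{s\times s}$. Let $\mathcal{X},\mathcal{Y}\in F^{n\times n}$ be regular (i.e. with nonzero determinant in $F$), let $f\in F$, and let $\mathrm{a}(x)\in F[x]\setminus\{0\}$ be a polynomial such that $\mathrm{a}(f\mathbf{I}_n-\mathcal{X}\mathcal{A}\mathcal{Y})\equiv 0$. Let $P\subset D$ be the set of isolated poles at which $f$, an entry of $\mathcal{M}$, $\mathcal{X}$ or $\mathcal{Y}$, or a coefficient of $\mathrm{a}(x)$ is not defined, and let $D_P=D\setminus P$. Set $$\mathcal{P}=\mathcal{Y}\,\mathrm{p}(f,f\mathbf{I}_n-\mathcal{X}\mathcal{A}\mathcal{Y};\mathrm{a})\,\mathcal{X},\qquad \mathcal{S}=\mathrm{a}(f)\,\mathcal{D}-\mathcal{C}\mathcal{P}\mathcal{B}\in F^{s\times s}.$$ For $g\in F$ let $\rho(g)$ denote the set of all distinct roots of $g$ in $D_P$. Then (i) $\rho(\det(\mathcal{M}))\subseteq G(\mathcal{S})\cup\rho(\det(\mathcal{A}))\subseteq G(\mathcal{M})\cup\rho(\mathrm{a}(f))$; and (ii) $\rho(\det(\mathcal{M}))\subseteq K(\mathcal{S})\cup\rho(\det(\mathcal{A}))\subseteq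 K(\mathcal{M})\cup\rho(\mathrm{a}(f))$.
   Context: For a polynomial $\mathrm{a}(x)=\sum_{k=0}^{d}a_kx^k\in F[x]$, $f\in F$ and $\mathcal{Z}\in F^{n\times n}$, put $\mathrm{p}(f,\mathcal{Z};\mathrm{a})=\sum_{k=1}^{d}a_k\sum_{i=1}^{k}f^{\,i-1}\mathcal{Z}^{k-i}$. For a square matrix $\mathcal{Z}$ over $F$, the (row based) Gershgorin region $G(\mathcal{Z})$ and Brauer region $K(\mathcal{Z})$ are, with $\lambda$ ranging over $D_P$, $$G(\mathcal{Z})=\bigcup_i\Bigl\{\lambda:\ |\mathcal{Z}_{ii}(\lambda)|\le\sum_{j\ne i}|\mathcal{Z}_{ij}(\lambda)|\Bigr\},$$ $$K(\mathcal{Z})=\bigcup_{i<k}\Bigl\{\lambda:\ |\mathcal{Z}_{ii}(\lambda)\mathcal{Z}_{kk}(\lambda)|\le\sum_{j\ne i}|\mathcal{Z}_{ij}(\lambda)|\,\sum_{l\ne k}|\mathcal{Z}_{kl}(\lambda)|\Bigr\}.$$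
   Formalization: The first inclusion of (ii), ρ(det M) ⊆ K(S) ∪ ρ(det A), is stated only for s ≥ 2, because for s = 1 the union over i<k defining K(S) is empty and the inclusion fails (e.g. n = s = 1, A = X = Y = B = C = 1, D = z, f = 0, a = x + 1). *)

(* Defs.v *)
From HB Require Import structures.
From mathcomp Require Import all_boot all_order all_algebra.
From mathcomp Require Import ring_quotient generic_quotient complex.
From mathcomp Require Import all_classical all_reals all_analysis.

Set Implicit Arguments.
Unset Strict Implicit.
Unset Printing Implicit Defensive.

Import Order.TTheory GRing.Theory Num.Theory.
Import numFieldNormedType.Exports.

Local Open Scope classical_set_scope.
Local Open Scope ring_scope.

(* The complex plane. Naming it as a [numClosedFieldType] is what gives its
   carrier the topology and the normed-space structure of a numeric field. *)
Definition Cplx (R : realType) : numClosedFieldType := complex R.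

Section Meromorphic.
Variable K : numClosedFieldType.

(* [derivable] over the scalar field [K] itself is complex differentiability. *)
Definition holomorphic_at (h : K -> K) (z : K) : Prop :=
  \forall w \near z, derivable h w 1.

(* The value [f z] itself is irrelevant; [m = 0] covers the points where [f]
   is holomorphic up to a removable singularity. *)
Definition meromorphic_at (f : K -> K) (z : K) : Prop :=
  exists (m : nat) (h : K -> K),
    holomorphic_at h z /\ \forall w \near z^', f w = h w / (w - z) ^+ m.

Record domain := Domain {
  domain_set : set K;
  domain_open : open domain_set;
  domain_connected : connected domain_set;
  domain_nonempty : domain_set !=set0 }.

Lemma holomorphic_atD f g z :
  holomorphic_at f z -> holomorphic_at g z -> holomorphic_at (f + g) z.
Proof. by move=> hf hg; near=> w; apply: derivableD; near: w. Unshelve. all: by end_near. Qed.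

Lemma holomorphic_atN f z : holomorphic_at f z -> holomorphic_at (- f) z.
Proof. by move=> hf; near=> w; apply: derivableN; near: w. Unshelve. all: by end_near. Qed.

Lemma holomorphic_atM f g z :
  holomorphic_at f z -> holomorphic_at g z -> holomorphic_at (f * g) z.
Proof. by move=> hf hg; near=> w; apply: derivableM; near: w. Unshelve. all: by end_near. Qed.

Lemma holomorphic_at_cst (c : K) z : holomorphic_at (cst c) z.
Proof. by near=> w; apply: derivable_cst. Unshelve. all: by end_near. Qed.

Lemma holomorphic_at_monomial (z0 : K) m z :
  holomorphic_at (fun w => (w - z0) ^+ m) z.
Proof.
near=> w.
have hd : derivable (id - cst z0 : K -> K) w 1.
  by apply: derivableB; [exact: derivable_id | exact: derivable_cst].
rewrite (_ : (fun w => _) = (id - cst z0 : K -> K) ^+ m); first exact: derivableX.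
by apply/funext => x; rewrite fctE.
Unshelve. all: by end_near. Qed.

Lemma meromorphic_at_cst (c : K) z : meromorphic_at (cst c) z.
Proof.
exists 0%N, (cst c); split; first exact: holomorphic_at_cst.
by near=> w; rewrite expr0 divr1.
Unshelve. all: by end_near. Qed.

Lemma meromorphic_atN f z : meromorphic_at f z -> meromorphic_at (- f) z.
Proof.
move=> [m [h [hh fh]]]; exists m, (- h); split; first exact: holomorphic_atN.
near=> w; have -> : (- f) w = - f w by [].
by have -> : f w = h w / (w - z) ^+ m; [near: w | rewrite -mulNr].
Unshelve. all: by end_near. Qed.

Lemma meromorphic_atD f g z :
  meromorphic_at f z -> meromorphic_at g z -> meromorphic_at (f + g) z.
Proof.
move=> [m [h [hh fh]]] [m' [h' [hh' gh]]].
exists (m + m')%N,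
  (h * (fun w => (w - z) ^+ m') + h' * (fun w => (w - z) ^+ m)).
split.
  by apply: holomorphic_atD; apply: holomorphic_atM => //;
    exact: holomorphic_at_monomial.
near=> w; have -> : (f + g) w = f w + g w by [].
have -> : f w = h w / (w - z) ^+ m by near: w.
have -> : g w = h' w / (w - z) ^+ m' by near: w.
have wz : w - z != 0 by rewrite subr_eq0; near: w; exact: nbhs_dnbhs_neq.
rewrite addf_div ?expf_neq0 // -exprD.
by congr (_ / _).
Unshelve. all: by end_near. Qed.

Lemma meromorphic_atM f g z :
  meromorphic_at f z -> meromorphic_at g z -> meromorphic_at (f * g) z.
Proof.
move=> [m [h [hh fh]]] [m' [h' [hh' gh]]].
exists (m + m')%N, (h * h'); split; first exact: holomorphic_atM.
near=> w; have -> : (f * g) w = f w * g w by [].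
have -> : f w = h w / (w - z) ^+ m by near: w.
have -> : g w = h' w / (w - z) ^+ m' by near: w.
by rewrite mulf_div -exprD.
Unshelve. all: by end_near. Qed.

Section Field.
Variable D : domain.

Definition meromorphic_on : {pred K -> K} :=
  fun f => `[< forall z, domain_set D z -> meromorphic_at f z >].

Lemma meromorphic_on_subring : subring_closed meromorphic_on.
Proof.
split.
- by apply/asboolP => z _; exact: meromorphic_at_cst.
- move=> f g /asboolP hf /asboolP hg; apply/asboolP => z Dz.
  by apply: meromorphic_atD; [exact: hf | apply: meromorphic_atN; exact: hg].
- move=> f g /asboolP hf /asboolP hg; apply/asboolP => z Dz.
  by apply: meromorphic_atM; [exact: hf | exact: hg].
Qed.

HB.instance Definition _ :=
  GRing.isSubringClosed.Build (K -> K) meromorphic_on meromorphic_on_subring.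

(* A total function standing for a meromorphic one; its values at the poles
   (and anywhere outside [D]) are junk. *)
Record merofun := MeroFun {
  merofun_val :> K -> K;
  merofun_valP : merofun_val \in meromorphic_on }.

HB.instance Definition _ := [isSub for merofun_val].
HB.instance Definition _ := [Choice of merofun by <:].
HB.instance Definition _ := [SubChoice_isSubComNzRing of merofun by <:].

Definition dnbhs_null : {pred merofun} :=
  fun f => `[< forall z, domain_set D z -> \forall w \near z^', f w = 0 >].

Lemma dnbhs_null_ideal : idealr_closed dnbhs_null.
Proof.
split.
- by apply/asboolP => z _; near=> w.
- apply/negP => /asboolP h1; have [z Dz] := domain_nonempty D.
  have : \forall w \near z^', False.
    by apply: filterS (h1 z Dz) => w /eqP; rewrite oner_eq0.
  by move=> /filter_ex[].
- move=> a f g /asboolP hf /asboolP hg; apply/asboolP => z Dz; near=> w.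
  have -> : (a * f + g) w = a w * f w + g w by [].
  have -> : f w = 0 by near: w; exact: hf.
  have -> : g w = 0 by near: w; exact: hg.
  by rewrite mulr0 addr0.
Unshelve. all: by end_near. Qed.

HB.instance Definition _ :=
  isIdealr.Build merofun dnbhs_null dnbhs_null_ideal.

(* The meromorphic functions on [D]: two functions are identified when they
   agree on a punctured neighbourhood of every point of [D], i.e. off a
   discrete closed subset of [D], so that values at poles and removable
   singularities do not matter. Only the commutative ring structure is
   registered: inverses are not needed to state anything below. *)
Definition mero : Type := {ideal_quot dnbhs_null}.

HB.instance Definition _ := GRing.ComNzRing.on mero.

Definition mero_repr (g : mero) : K -> K := repr (g : {ideal_quot dnbhs_null}).

Lemma mero_repr_pi (u : merofun) z : domain_set D z ->
  \forall w \near z^', mero_repr (\pi_({ideal_quot dnbhs_null}) u)%qT w = u w.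
Proof.
move=> Dz; rewrite /mero_repr; set v := repr _.
have : v - u \in dnbhs_null by rewrite Quotient.idealrBE reprK.
move=> /asboolP /(_ z Dz); apply: filterS => w.
by rewrite (_ : (v - u) w = v w - u w) // => /subr0_eq.
Qed.

Definition defined_at (g : mero) (z : K) : Prop :=
  exists h : K -> K,
    holomorphic_at h z /\ \forall w \near z^', mero_repr g w = h w.

(* The value at [z] of the holomorphic extension; meaningful under
   [defined_at g z]. *)
Definition mero_val (g : mero) (z : K) : K := lim (mero_repr g w @[w --> z^']).

Lemma mero_valE (g : mero) (h : K -> K) z : holomorphic_at h z ->
  (\forall w \near z^', mero_repr g w = h w) -> mero_val g z = h z.
Proof.
move=> hh gh; apply: cvg_lim => //.
have hz : {for z, continuous h}.
  apply: differentiable_continuous; apply/derivable1_diffP.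
  exact: nbhs_singleton hh.
apply: cvg_trans (cvg_trans (cvg_app h (@nbhs_dnbhs _ z)) hz).
by apply: near_eq_cvg; apply: filterS gh.
Qed.

Definition pole_set n m (f : mero) (M : 'M[mero]_m) (X Y : 'M[mero]_n)
    (a : {poly mero}) : set K :=
  [set z | domain_set D z /\
    [\/ ~ defined_at f z, exists i j, ~ defined_at (M i j) z,
        (exists i j, ~ defined_at (X i j) z) \/
          (exists i j, ~ defined_at (Y i j) z)
      | exists k, ~ defined_at a`_k z]].

(* In the next three definitions [W] is the set over which the spectral
   parameter ranges. *)
Definition zero_set (W : set K) (g : mero) : set K :=
  [set z | W z /\ mero_val g z = 0].

Definition gershgorin (W : set K) m (Z : 'M[mero]_m) : set K :=
  [set z | W z /\ exists i : 'I_m,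
    `|mero_val (Z i i) z| <= \sum_(j < m | j != i) `|mero_val (Z i j) z|].

Definition brauer (W : set K) m (Z : 'M[mero]_m) : set K :=
  [set z | W z /\ exists i k : 'I_m, (i < k)%N /\
    `|mero_val (Z i i) z * mero_val (Z k k) z| <=
      (\sum_(j < m | j != i) `|mero_val (Z i j) z|) *
      (\sum_(l < m | l != k) `|mero_val (Z k l) z|)].

End Field.
End Meromorphic.

(* sum_(k = 1 .. d) a_k sum_(i = 1 .. k) f^(i-1) Z^(k-i), with [size a = d + 1]. *)
Definition ppoly (F : comNzRingType) n (f : F) (Z : 'M[F]_n) (a : {poly F}) :
    'M[F]_n :=
  \sum_(1 <= k < size a)
    a`_k *: \sum_(1 <= i < k.+1) f ^+ (i - 1) *: Z ^+ (k - i).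

(* Main.v *)
Require Import Defs.
From HB Require Import structures.
From mathcomp Require Import all_boot all_order all_algebra.
From mathcomp Require Import ring_quotient generic_quotient complex.
From mathcomp Require Import all_classical all_reals all_analysis.
From mathcomp Require Import ring lra.

(* Fix a point [z] of [D] that is not a pole of the data, and let [al] be the
   value of [a(f)] at [z]. Telescoping gives
   [p(f, Z; a) (f I - Z) = a(f) I - a(Z) = a(f) I], hence [P A Y = a(f) Y] near
   [z]. The determinant of [Y] vanishes identically near no point of [D], by the
   identity theorem, so that [P A = al I] at [z] even when [Y] is singular there.

   If [det A <> 0] at [z], then [S] is [al] times the Schur complement of [A] in
   [M], so it is singular whenever [M] is, and the theorems of Gershgorin and
   Brauer apply to it. If [al <> 0] then [A] is invertible at [z]. Given a row [i]
   of [S] violating diagonal dominance, choose [y] with [y i = 1], the other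
   entries small, and [(S y) i = 0]; completing it by [x = - A^-1 B y] gives a
   vector annihilated by the row [i] and by all the top rows of [M], and its
   entries of largest modulus single out a row, or a pair of rows, of [M]
   violating the corresponding dominance condition.

   The identity theorem rests on Goursat's lemma for rectangles and Cauchy's
   formula: if [h] vanishes near [c], then [h w / (w - c) ^+ n] is differentiable
   for every [n], and Cauchy's formula for it gives, as [n] grows, that [h]
   vanishes on a disc whose radius does not depend on [n]. *)

Set Implicit Arguments.
Unset Strict Implicit.
Unset Printing Implicit Defensive.

Import Order.TTheory GRing.Theory Num.Theory.
Import numFieldNormedType.Exports Normc.

Local Open Scope classical_set_scope.
Local Open Scope ring_scope.

(** * Integrals along segments and rectangles *)

Section IntervalIntegral.
Variable R : realType.
Local Notation mu := (@lebesgue_measure R).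
Implicit Types (u v : R -> R) (a b t : R).

Definition itg (a b : R) (u : R -> R) : Prop :=
  mu.-integrable `[a, b] (EFin \o u).

Definition rint (u : R -> R) (a b : R) : R := Rintegral mu `[a, b] u.

Lemma itg_continuous (u : R -> R) a b :
  (forall t, a <= t <= b -> {for t, continuous u}) -> itg a b u.
Proof.
move=> cu; apply: continuous_compact_integrable; first exact: segment_compact.
by apply: continuous_in_subspaceT => t; rewrite inE /= in_itv /=; exact: cu.
Qed.

Lemma itgD a b u v : itg a b u -> itg a b v -> itg a b (fun t => u t + v t).
Proof. by move=> iu iv; exact: (integrableD _ iu iv). Qed.

Lemma itgZ a b k u : itg a b u -> itg a b (fun t => k * u t).
Proof. by move=> iu; exact: (integrableZl _ k iu). Qed.

Lemma rint_cst k a b : a <= b -> rint (fun=> k) a b = k * (b - a).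
Proof.
move=> ab; rewrite /rint Rintegral_cst //= lebesgue_measure_itv /= lte_fin.
by case: ltgtP ab => //= -> _; rewrite subrr.
Qed.

Lemma rint_id a b : a <= b -> rint id a b = (b ^+ 2 - a ^+ 2) / 2.
Proof.
rewrite le_eqVlt => /predU1P[->|ab].
  by rewrite subrr mul0r /rint set_itv1 Rintegral_set1.
pose P (t : R) := t ^+ 2 / 2.
have dP (t : R) : is_derive t 1 P t.
  rewrite /P; apply: (@is_derive_eq _ _ _ _ _ _ _ _); rewrite /GRing.scale /=. 
  by field.
have derP (t : R) : derivable P t 1 by case: (dP t).
have cP : continuous P.
  by move=> t; apply: differentiable_continuous; exact/derivable1_diffP.
rewrite /rint /Rintegral (@continuous_FTC2 _ id P) //=.
- by rewrite /P; field.
- by apply: continuous_subspaceT => t; exact: cvg_id.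
- split => //.
  + by apply: cvg_at_right_filter; exact: cP.
  + by apply: cvg_at_left_filter; exact: cP.
- by move=> t _; rewrite derive1E; case: (dP t).
Qed.

Lemma rint_split u a b x : a <= x -> x <= b -> itg a b u ->
  rint u a b = rint u a x + rint u x b.
Proof.
move=> ax xb iu; rewrite {3}/rint -Rintegral_itv_obnd_cbnd; last first.
  by apply: integrableS iu => //; apply: subset_itv; rewrite bnd_simp.
rewrite -(@Rintegral_itvB _ u (BLeft a) (BRight b) x) ?bnd_simp //.
by rewrite /rint addrC subrK.
Qed.

Lemma le_rint u v a b : itg a b u -> itg a b v ->
  (forall t, a <= t <= b -> u t <= v t) -> rint u a b <= rint v a b.
Proof. by move=> iu iv uv; apply: le_Rintegral => // t /=; rewrite in_itv; exact: uv. Qed.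

Lemma itg_cst a b (k : R) : itg a b (fun=> k).
Proof. by apply: itg_continuous => t _; exact: cst_continuous. Qed.

Lemma rint_ge u a b m : a <= b -> itg a b u ->
  (forall t, a <= t <= b -> m <= u t) -> m * (b - a) <= rint u a b.
Proof.
move=> ab iu um; rewrite -rint_cst //; apply: le_rint => //; exact: itg_cst.
Qed.

Lemma rint_norm_le u a b B : a <= b -> itg a b u ->
  (forall t, a <= t <= b -> `|u t| <= B) -> `|rint u a b| <= B * (b - a).
Proof.
move=> ab iu uB; rewrite ler_norml -mulNr -!rint_cst //; apply/andP; split;
  apply: le_rint => //; try exact: itg_cst;
  by move=> t /uB; rewrite ler_norml => /andP[].
Qed.

Lemma rintD u v a b : itg a b u -> itg a b v ->
  rint (fun t => u t + v t) a b = rint u a b + rint v a b.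
Proof. by move=> iu iv; exact: RintegralD. Qed.

Lemma rintZ k u a b : itg a b u -> rint (fun t => k * u t) a b = k * rint u a b.
Proof. by move=> iu; exact: RintegralZl. Qed.

Lemma eq_rint u v a b : (forall t, a <= t <= b -> u t = v t) ->
  rint u a b = rint v a b.
Proof. by move=> uv; apply: eq_Rintegral => t; rewrite inE /= in_itv /=; exact: uv. Qed.

Lemma eq_itg u v a b : (forall t, a <= t <= b -> u t = v t) ->
  itg a b u -> itg a b v.
Proof.
move=> uv; apply: eq_integrable => // t.
by rewrite inE /= in_itv /= => /uv ->.
Qed.

End IntervalIntegral.

Section ComplexPlane.
Variable R : realType.
Local Notation K := (Cplx R).
Local Notation Re := (@complex.Re R).
Local Notation Im := (@complex.Im R).
Implicit Types (f : K -> K) (c p z w : K).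

Lemma cplx_eq z w : Re z = Re w -> Im z = Im w -> z = w.
Proof. by case: z w => [a b] [c d] /= -> ->. Qed.

Lemma cReD z w : Re (z + w) = Re z + Re w.
Proof. by case: z w => [a b] [c d]. Qed.
Lemma cImD z w : Im (z + w) = Im z + Im w.
Proof. by case: z w => [a b] [c d]. Qed.
Lemma cReN z : Re (- z) = - Re z.
Proof. by case: z. Qed.
Lemma cImN z : Im (- z) = - Im z.
Proof. by case: z. Qed.
Lemma cReM z w : Re (z * w) =
  Re z * Re w - Im z * Im w.
Proof. by case: z w => [a b] [c d]. Qed.
Lemma cImM z w : Im (z * w) =
  Re z * Im w + Im z * Re w.
Proof. by case: z w => [a b] [c d]. Qed.
Lemma cReV z : Re z^-1 =
  Re z / (Re z ^+ 2 + Im z ^+ 2).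
Proof. by case: z. Qed.
Lemma cImV z : Im z^-1 =
  - (Im z / (Re z ^+ 2 + Im z ^+ 2)).
Proof. by case: z => a b /=; rewrite ?mulNr. Qed.

Definition cplxE := (cReD, cImD, cReN, cImN, cReM, cImM).

Lemma normc_ge0 z : 0 <= normc z.
Proof. by case: z => a b; exact: sqrtr_ge0. Qed.

Lemma normc_gt0 z : (0 < normc z) = (z != 0).
Proof.
rewrite lt_neqAle normc_ge0 andbT; congr negb; apply/eqP/eqP => [e|->].
  by apply: eq0_normc.
by rewrite normc0.
Qed.

Lemma normr_normc z : `|z| = (normc z)%:C%C :> K.
Proof. by case: z => a b; rewrite normc_def. Qed.

Lemma normc_ltE z (d : R) : (`|z| < (d%:C%C : K)) = (normc z < d).
Proof. by rewrite normr_normc ltcR. Qed.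

Lemma Re_le_normc z : `|Re z| <= normc z.
Proof.
case: z => a b /=; rewrite -sqrtr_sqr ler_sqrt ?addr_ge0 ?sqr_ge0 //.
by rewrite lerDl sqr_ge0.
Qed.

Lemma Im_le_normc z : `|Im z| <= normc z.
Proof.
case: z => a b /=; rewrite -sqrtr_sqr ler_sqrt ?addr_ge0 ?sqr_ge0 //.
by rewrite lerDr sqr_ge0.
Qed.

Lemma normc_le_ReIm z : normc z <= `|Re z| + `|Im z|.
Proof.
case: z => a b /=; rewrite -[leRHS]ger0_norm ?addr_ge0 // -sqrtr_sqr.
rewrite ler_sqrt ?sqr_ge0 // sqrrD !real_normK ?num_real // addrAC lerDl.
by rewrite mulrn_wge0 // mulr_ge0.
Qed.

Lemma normc_triangle z w : normc (z + w) <= normc z + normc w.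
Proof. exact: le_normcD. Qed.

Lemma normc_dist z p w : normc (z - w) <= normc (z - p) + normc (p - w).
Proof. by have := normc_triangle (z - p) (p - w); rewrite addrA subrK. Qed.

Lemma normc_opp z : normc (- z) = normc z.
Proof. exact: normcN. Qed.

Lemma normcB z w : normc (z - w) = normc (w - z).
Proof. by rewrite -normc_opp opprB. Qed.

Lemma gt0_cplx (e : K) : 0 < e -> exists2 d : R, 0 < d & e = d%:C%C.
Proof.
case: e => a b; rewrite ltcE /= => /andP[/eqP -> a0].
by exists a.
Qed.

Lemma nbhs_normcP z (A : set K) :
  nbhs z A <-> exists2 d : R, 0 < d & forall w, normc (w - z) < d -> A w.
Proof.
rewrite -nbhs_ballE; split.
  move=> [e /= /gt0_cplx[d d0 ->] sA]; exists d => // w wd.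
  by apply: sA; rewrite /ball /= normc_ltE normcB.
move=> [d d0 sA]; exists d%:C%C; rewrite /= ?ltcR // => w.
by rewrite /ball /= normc_ltE normcB => /sA.
Qed.

Lemma derivable_estimate f p : derivable f p 1 -> exists l : K,
  forall e : R, 0 < e -> exists2 d : R, 0 < d & forall w, normc (w - p) < d ->
    normc (f w - f p - l * (w - p)) <= e * normc (w - p).
Proof.
move=> /derivable_nbhs /eqaddoP df; exists ('D_1 f p) => e e0.
have /df : 0 < (e%:C%C : K) by rewrite ltcR.
move=> /nbhs_normcP[d d0 H]; exists d => // w wd.
have := H (w - p); rewrite subr0 => /(_ wd) /=.
rewrite !normr_normc -rmorphM lecR.
rewrite -[X in normc X]/(f ((w - p) *: (1 : K) + p) - (f p + (w - p) *: 'D_1 f p)).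
by rewrite /GRing.scale /= mulr1 subrK opprD addrA (mulrC (w - p)).
Qed.

Lemma derivable_continuous f p : derivable f p 1 -> {for p, continuous f}.
Proof. by move=> ?; apply: differentiable_continuous; apply/derivable1_diffP. Qed.

Lemma continuous_normc f p : {for p, continuous f} -> forall e : R, 0 < e ->
  exists2 d : R, 0 < d & forall w, normc (w - p) < d -> normc (f w - f p) < e.
Proof.
move=> cf e e0; apply/nbhs_normcP.
apply: (cf [set v | normc (v - f p) < e]); apply/nbhs_normcP.
by exists e.
Qed.

End ComplexPlane.

Section RectangleIntegral.
Variable R : realType.
Local Notation K := (Cplx R).
Local Notation Re := (@complex.Re R).
Local Notation Im := (@complex.Im R).
Implicit Types (F G : R -> K) (f g : K -> K) (a b t x y : R) (c z w : K).

Definition citg a b F : Prop :=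
  itg a b (fun t => Re (F t)) /\ itg a b (fun t => Im (F t)).

Definition cint F a b : K :=
  Complex (rint (fun t => Re (F t)) a b) (rint (fun t => Im (F t)) a b).

Lemma eq_cint F G a b : (forall t, a <= t <= b -> F t = G t) ->
  cint F a b = cint G a b.
Proof.
by move=> FG; apply: cplx_eq => /=; apply: eq_rint => t /FG ->.
Qed.

Lemma cintD F G a b : citg a b F -> citg a b G ->
  cint (fun t => F t + G t) a b = cint F a b + cint G a b.
Proof.
move=> [? ?] [? ?]; apply: cplx_eq; rewrite cplxE /= -rintD //;
  by apply: eq_rint => t _; rewrite cplxE.
Qed.

Lemma cintZ c F a b : citg a b F -> cint (fun t => c * F t) a b = c * cint F a b.
Proof.
move=> [iR iI]; apply: cplx_eq; rewrite cplxE /= -?mulNr -!rintZ //.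
  rewrite -rintD; [|exact: itgZ..].
  by apply: eq_rint => t _; rewrite cplxE mulNr.
rewrite -rintD; [|exact: itgZ..].
by apply: eq_rint => t _; rewrite cplxE.
Qed.

Lemma citgZ c F a b : citg a b F -> citg a b (fun t => c * F t).
Proof.
move=> [iR iI]; split.
  apply: eq_itg (itgD (itgZ (Re c) iR) (itgZ (- Im c) iI)) => t _.
  by rewrite cplxE mulNr.
by apply: eq_itg (itgD (itgZ (Re c) iI) (itgZ (Im c) iR)) => t _; rewrite cplxE.
Qed.

Lemma cint_split F a b x : a <= x -> x <= b -> citg a b F ->
  cint F a b = cint F a x + cint F x b.
Proof.
by move=> ax xb [? ?]; apply: cplx_eq; rewrite cplxE /=; apply: rint_split.
Qed.

Lemma citg_real a b : citg a b (fun t => t%:C%C : K).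
Proof.
split => /=; last exact: itg_cst.
by apply: itg_continuous => t _; exact: cvg_id.
Qed.

Lemma citg_cst a b c : citg a b (fun=> c).
Proof. by split; exact: itg_cst. Qed.

Lemma cint_affine c z a b : a <= b ->
  cint (fun t => c + z * t%:C%C) a b =
  c * (b - a)%:C%C + z * ((b ^+ 2 - a ^+ 2) / 2)%:C%C.
Proof.
move=> ab; rewrite cintD; [|exact: citg_cst|exact: citgZ (citg_real _ _)].
rewrite cintZ; last exact: citg_real.
congr (_ + _ * _); apply: cplx_eq; rewrite ?cplxE /= ?rint_cst //=; try by ring.
by rewrite rint_id.
Qed.

Lemma cint_normc_le F a b (B : R) : a <= b -> citg a b F ->
  (forall t, a <= t <= b -> normc (F t) <= B) ->
  normc (cint F a b) <= 2 * B * (b - a).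
Proof.
move=> ab [iR iI] FB; apply: (le_trans (normc_le_ReIm _)).
rewrite -mulrA mulr_natl mulr2n; apply: lerD; apply: rint_norm_le => // t /FB.
  by apply: le_trans; exact: Re_le_normc.
by apply: le_trans; exact: Im_le_normc.
Qed.

Definition path_cont a b F : Prop :=
  forall t, a <= t <= b -> forall e : R, 0 < e -> exists2 d : R, 0 < d &
    forall t', `|t' - t| < d -> normc (F t' - F t) < e.

Lemma citg_continuous F a b : path_cont a b F -> citg a b F.
Proof.
move=> cF; split; apply: itg_continuous => t tab; apply/cvgrPdist_lt => e e0;
  have [d d0 Hd] := cF t tab e e0; apply/nbhs_ballP; exists d => //= t';
  rewrite /ball /= distrC => /Hd; apply: le_lt_trans; rewrite distrC.
  by have := Re_le_normc (F t' - F t); rewrite !cplxE.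
by have := Im_le_normc (F t' - F t); rewrite !cplxE.
Qed.

Lemma path_cont_bounded F a b : a <= b -> path_cont a b F ->
  exists M : R, forall t, a <= t <= b -> normc (F t) <= M.
Proof.
move=> ab cF; have cN : {within `[a, b], continuous (fun t => normc (F t))}.
  apply: continuous_in_subspaceT => t; rewrite inE /= in_itv /= => tab.
  apply/cvgrPdist_lt => e e0; have [d d0 Hd] := cF t tab e e0.
  apply/nbhs_ballP; exists d => //= t'; rewrite /ball /= distrC => /Hd.
  apply: le_lt_trans; rewrite ler_norml.
  have := normc_triangle (F t' - F t) (F t).
  have := normc_triangle (F t - F t') (F t').
  by rewrite !subrK (normcB (F t)) => h1 h2; apply/andP; split; lra.
have [c _ cM] := EVT_max ab cN.
by exists (normc (F c)) => t tab; apply: cM; rewrite in_itv.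
Qed.

Lemma normc_real t : normc (t%:C%C : K) = `|t|.
Proof. by rewrite /= expr0n addr0 sqrtr_sqr. Qed.

Lemma normc_im t : normc (Complex 0 t : K) = `|t|.
Proof. by rewrite /= expr0n add0r sqrtr_sqr. Qed.

Lemma path_cont_horizontal f a b y :
  (forall t, a <= t <= b -> {for (Complex t y : K), continuous f}) ->
  path_cont a b (fun t => f (Complex t y)).
Proof.
move=> cf t tab e e0.
have [d d0 H] := continuous_normc (cf t tab) e0; exists d => // t' t'd.
apply: H; suff -> : Complex t' y - Complex t y = (t' - t)%:C%C :> K
  by rewrite normc_real.
by apply: cplx_eq; rewrite !cplxE //= subrr.
Qed.

Lemma path_cont_vertical f a b x :
  (forall t, a <= t <= b -> {for (Complex x t : K), continuous f}) ->
  path_cont a b (fun t => f (Complex x t)).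
Proof.
move=> cf t tab e e0.
have [d d0 H] := continuous_normc (cf t tab) e0; exists d => // t' t'd.
apply: H; suff -> : Complex x t' - Complex x t = Complex 0 (t' - t) :> K
  by rewrite normc_im.
by apply: cplx_eq; rewrite !cplxE //= subrr.
Qed.

Definition cplx_i : K := Complex 0 1.

Definition rect_integral f x1 x2 y1 y2 : K :=
  cint (fun t => f (Complex t y1)) x1 x2 + cplx_i * cint (fun t => f (Complex x2 t)) y1 y2
  - cint (fun t => f (Complex t y2)) x1 x2 - cplx_i * cint (fun t => f (Complex x1 t)) y1 y2.

Definition in_rect x1 x2 y1 y2 z : bool :=
  (x1 <= Re z <= x2) && (y1 <= Im z <= y2).

Definition on_bd x1 x2 y1 y2 z : bool :=
  in_rect x1 x2 y1 y2 z &&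
  [|| Re z == x1, Re z == x2, Im z == y1 | Im z == y2].

Lemma on_bd_in x1 x2 y1 y2 z : on_bd x1 x2 y1 y2 z -> in_rect x1 x2 y1 y2 z.
Proof. by case/andP. Qed.

Lemma on_bdP (P : K -> Prop) x1 x2 y1 y2 : x1 <= x2 -> y1 <= y2 ->
  (forall w, on_bd x1 x2 y1 y2 w -> P w) ->
  [/\ forall t, x1 <= t <= x2 -> P (Complex t y1),
      forall t, x1 <= t <= x2 -> P (Complex t y2),
      forall t, y1 <= t <= y2 -> P (Complex x1 t) &
      forall t, y1 <= t <= y2 -> P (Complex x2 t)].
Proof.
move=> x12 y12 H; split=> t tI; apply: H;
  by rewrite /on_bd /in_rect /= ?tI ?x12 ?y12 ?eqxx ?lexx ?orbT.
Qed.

Section Fixed.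
Variables x1 x2 y1 y2 : R.
Hypotheses (x12 : x1 <= x2) (y12 : y1 <= y2).
Local Notation bd := (on_bd x1 x2 y1 y2).
Local Notation II f := (rect_integral f x1 x2 y1 y2).

Lemma citg_bd f : (forall w, bd w -> {for w, continuous f}) ->
  [/\ citg x1 x2 (fun t => f (Complex t y1)), citg x1 x2 (fun t => f (Complex t y2)),
      citg y1 y2 (fun t => f (Complex x1 t)) & citg y1 y2 (fun t => f (Complex x2 t))].
Proof.
move=> /(on_bdP x12 y12)[? ? ? ?].
by split; apply: citg_continuous;
  (apply: path_cont_horizontal || apply: path_cont_vertical).
Qed.

Lemma bd_bounded f : (forall w, bd w -> {for w, continuous f}) ->
  exists M : R, forall w, bd w -> normc (f w) <= M.
Proof.
move=> /(on_bdP x12 y12)[c1 c2 c3 c4].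
have [M1 h1] := path_cont_bounded x12 (path_cont_horizontal c1).
have [M2 h2] := path_cont_bounded x12 (path_cont_horizontal c2).
have [M3 h3] := path_cont_bounded y12 (path_cont_vertical c3).
have [M4 h4] := path_cont_bounded y12 (path_cont_vertical c4).
exists (Num.max (Num.max M1 M2) (Num.max M3 M4)) => -[a b] /andP[/andP[/= ax bx]].
by case/or4P => /eqP ?; subst; rewrite !le_max ?h1 ?h2 ?h3 ?h4 ?orbT.
Qed.

Lemma eq_rectI f g : (forall w, bd w -> f w = g w) -> II f = II g.
Proof.
move=> /(on_bdP x12 y12)[? ? ? ?]; rewrite /rect_integral.
by do ![congr (_ + _) | congr (- _) | congr (_ * _)]; apply: eq_cint.
Qed.

Lemma rect_integralD f g : (forall w, bd w -> {for w, continuous f}) ->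
  (forall w, bd w -> {for w, continuous g}) ->
  II (fun w => f w + g w) = II f + II g.
Proof.
move=> /citg_bd[? ? ? ?] /citg_bd[? ? ? ?]; rewrite /rect_integral !cintD //.
by rewrite !mulrDr !opprD; ring.
Qed.

Lemma rect_integralZ c f : (forall w, bd w -> {for w, continuous f}) ->
  II (fun w => c * f w) = c * II f.
Proof.
by move=> /citg_bd[? ? ? ?]; rewrite /rect_integral !cintZ //; ring.
Qed.

Lemma rect_integral_normc_le f (B : R) : (forall w, bd w -> {for w, continuous f}) ->
  (forall w, bd w -> normc (f w) <= B) ->
  normc (II f) <= 4 * B * ((x2 - x1) + (y2 - y1)).
Proof.
move=> /citg_bd[? ? ? ?] /(on_bdP x12 y12)[? ? ? ?]; rewrite /rect_integral.
have nI (w : K) : normc (cplx_i * w) = normc w.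
  by rewrite normcM normc_im normr1 mul1r.
apply: (le_trans (normc_triangle _ _)).
rewrite normc_opp nI.
have h1 := normc_triangle (cint (fun t => f (Complex t y1)) x1 x2 +
  cplx_i * cint (fun t => f (Complex x2 t)) y1 y2) (- cint (fun t => f (Complex t y2)) x1 x2).
have h2 := normc_triangle (cint (fun t => f (Complex t y1)) x1 x2)
  (cplx_i * cint (fun t => f (Complex x2 t)) y1 y2).
rewrite normc_opp in h1; rewrite nI in h2.
have h3 : normc (cint (fun t => f (Complex t y1)) x1 x2) <= 2 * B * (x2 - x1)
  by apply: cint_normc_le.
have h4 : normc (cint (fun t => f (Complex t y2)) x1 x2) <= 2 * B * (x2 - x1)
  by apply: cint_normc_le.
have h5 : normc (cint (fun t => f (Complex x1 t)) y1 y2) <= 2 * B * (y2 - y1)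
  by apply: cint_normc_le.
have h6 : normc (cint (fun t => f (Complex x2 t)) y1 y2) <= 2 * B * (y2 - y1)
  by apply: cint_normc_le.
lra.
Qed.

Lemma rect_integral_affine c z : II (fun w => c + z * w) = 0.
Proof.
rewrite /rect_integral.
have hE y : cint (fun t => c + z * Complex t y) x1 x2 =
    (c + z * Complex 0 y) * (x2 - x1)%:C%C + z * ((x2 ^+ 2 - x1 ^+ 2) / 2)%:C%C.
  rewrite -cint_affine //; apply: eq_cint => t _.
  by apply: cplx_eq; rewrite !cplxE /=; ring.
have vE x : cint (fun t => c + z * Complex x t) y1 y2 =
    (c + z * x%:C%C) * (y2 - y1)%:C%C + z * cplx_i * ((y2 ^+ 2 - y1 ^+ 2) / 2)%:C%C.
  rewrite -cint_affine //; apply: eq_cint => t _.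
  by apply: cplx_eq; rewrite !cplxE /=; ring.
by rewrite !hE !vE; apply: cplx_eq; rewrite !cplxE /=; field.
Qed.

End Fixed.

Lemma rect_integral_splitx f x1 x2 y1 y2 x : x1 <= x -> x <= x2 -> y1 <= y2 ->
  (forall w, on_bd x1 x2 y1 y2 w -> {for w, continuous f}) ->
  rect_integral f x1 x2 y1 y2 = rect_integral f x1 x y1 y2 + rect_integral f x x2 y1 y2.
Proof.
move=> x1x xx2 y12 /(citg_bd (le_trans x1x xx2) y12)[? ? ? ?]; rewrite /rect_integral.
rewrite (cint_split x1x xx2) // [cint _ x1 x2](cint_split x1x xx2) //.
by ring.
Qed.

Lemma rect_integral_splity f x1 x2 y1 y2 y : y1 <= y -> y <= y2 -> x1 <= x2 ->
  (forall w, on_bd x1 x2 y1 y2 w -> {for w, continuous f}) ->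
  rect_integral f x1 x2 y1 y2 = rect_integral f x1 x2 y1 y + rect_integral f x1 x2 y y2.
Proof.
move=> y1y yy2 x12 /(citg_bd x12 (le_trans y1y yy2))[? ? ? ?]; rewrite /rect_integral.
rewrite (cint_split y1y yy2) // [cint _ y1 y2](cint_split y1y yy2) //.
by ring.
Qed.

End RectangleIntegral.

(** * Goursat's lemma and Cauchy's formula *)

Lemma nested_point (R : realType) (u l : nat -> R) :
  (forall k, u k <= u k.+1) -> (forall k, u k.+1 + l k.+1 <= u k + l k) ->
  (forall k, 0 <= l k) -> exists p, forall k, u k <= p <= u k + l k.
Proof.
move=> u_inc ul_dec l_ge0.
have um : {homo u : i j / (i <= j)%N >-> i <= j}.
  by apply: homo_leq => //; exact: le_trans.
have ulm : {homo (fun k => u k + l k) : i j / (i <= j)%N >-> j <= i}.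
  apply: homo_leq => [x|y x z xy yz|k]; first exact: lexx.
  - exact: le_trans yz xy.
  - exact: ul_dec.
have ub i k : u i <= u k + l k.
  have [ik|ki] := leqP i k.
    by apply: le_trans (um _ _ ik) _; rewrite lerDl.
  apply: le_trans (ulm _ _ (ltnW ki)); by rewrite lerDl.
exists (sup (range u)) => k; apply/andP; split.
  apply: ub_le_sup; last by exists k.
  by exists (u 0%N + l 0%N) => _ [i _ <-].
by apply: ge_sup => [|_ [i _ <-]] //; exists (u 0%N); exists 0%N.
Qed.

Section Goursat.
Variable R : realType.
Local Notation K := (Cplx R).
Local Notation Re := (@complex.Re R).
Local Notation Im := (@complex.Im R).
Variables (f : K -> K) (x1 x2 y1 y2 : R).
Hypotheses (x12 : x1 < x2) (y12 : y1 < y2).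
Hypothesis df : forall w, in_rect x1 x2 y1 y2 w -> derivable f w 1.

Let L := x2 - x1.
Let H := y2 - y1.
Let l k := L / 2 ^+ k.
Let h k := H / 2 ^+ k.

Let inside k (p : R * R) : bool :=
  [&& x1 <= p.1, p.1 + l k <= x2, y1 <= p.2 & p.2 + h k <= y2].

Let II k (p : R * R) : K := rect_integral f p.1 (p.1 + l k) p.2 (p.2 + h k).

Let L0 : 0 < L. Proof. by rewrite subr_gt0. Qed.
Let H0 : 0 < H. Proof. by rewrite subr_gt0. Qed.
Let l0 k : 0 < l k. Proof. by rewrite divr_gt0 // exprn_gt0. Qed.
Let h0 k : 0 < h k. Proof. by rewrite divr_gt0 // exprn_gt0. Qed.
Let lS k : l k = l k.+1 + l k.+1.
Proof. by rewrite /l exprS; field; rewrite expf_neq0. Qed.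
Let hS k : h k = h k.+1 + h k.+1.
Proof. by rewrite /h exprS; field; rewrite expf_neq0. Qed.

Let inside_cont k p : inside k p ->
  forall w, on_bd p.1 (p.1 + l k) p.2 (p.2 + h k) w -> {for w, continuous f}.
Proof.
move=> /and4P[a1 a2 a3 a4] w /on_bd_in /andP[/andP[b1 b2] /andP[b3 b4]].
apply: derivable_continuous; apply: df; rewrite /in_rect.
by rewrite (le_trans a1) ?(le_trans b2) ?(le_trans a3) ?(le_trans b4).
Qed.

Let quarters k p : inside k p ->
  II k p = II k.+1 p + II k.+1 (p.1, p.2 + h k.+1) +
    (II k.+1 (p.1 + l k.+1, p.2) + II k.+1 (p.1 + l k.+1, p.2 + h k.+1)).
Proof.
move=> pin; have /and4P[a1 a2 a3 a4] := pin.
have lk := l0 k.+1; have hk := h0 k.+1.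
rewrite lS in a2; rewrite hS in a4.
have sub a b : x1 <= a -> b <= x2 ->
    forall w, on_bd a b p.2 (p.2 + h k) w -> {for w, continuous f}.
  move=> aa bb w /on_bd_in /andP[/andP[b1 b2] /andP[b3 b4]].
  apply: derivable_continuous; apply: df; rewrite /in_rect.
  rewrite hS in b4.
  by rewrite (le_trans aa) ?(le_trans b2) ?(le_trans a3) ?(le_trans b4).
rewrite /II (rect_integral_splitx (x := p.1 + l k.+1)); last exact: inside_cont.
- rewrite (rect_integral_splity (y := p.2 + h k.+1)) ?lerDl ?ltW //; first last.
  + by apply: sub => //; apply: le_trans a2; rewrite lerD2l lerDl ltW.
  + by rewrite [h k]hS ltrD2l ltrDl.
  rewrite [X in _ + X](rect_integral_splity (y := p.2 + h k.+1)) ?lerDl ?ltW //; first last.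
  + by apply: sub => //=; [apply: le_trans a1 _; rewrite lerDl ltW|rewrite [l k]lS].
  + by rewrite [l k]lS ltrD2l ltrDl.
  + by rewrite [h k]hS ltrD2l ltrDl.
  by rewrite /= -!addrA -!lS -!hS.
- by rewrite lerDl ltW.
- by rewrite [l k]lS lerD2l lerDl ltW.
- by rewrite lerDl ltW.
Qed.

Section Bisection.
Variable eta : R.
Hypothesis eta0 : 0 < eta.

Let bad k p : bool := eta * (l k * h k) < normc (II k p).

Let next k (p : R * R) : R * R :=
  if bad k.+1 p then p
  else if bad k.+1 (p.1, p.2 + h k.+1) then (p.1, p.2 + h k.+1)
  else if bad k.+1 (p.1 + l k.+1, p.2) then (p.1 + l k.+1, p.2)
  else (p.1 + l k.+1, p.2 + h k.+1).

Let bad_next k p : inside k p -> bad k p -> bad k.+1 (next k p).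
Proof.
move=> pin; rewrite /next.
case: ifP => //; case: ifP => //; case: ifP => // /negbT.
rewrite {1}/bad -leNgt => n1 /negbT; rewrite {1}/bad -leNgt => n2 /negbT.
rewrite {1}/bad -leNgt => n3; rewrite /bad (quarters pin).
set A := II _ p in n3 *; set B := II _ _ in n2 *; set C := II _ _ in n1 *.
set D := II _ _.
have t1 := normc_triangle (A + B) (C + D).
have t2 := normc_triangle A B; have t3 := normc_triangle C D.
rewrite [l k]lS [h k]hS => hb.
have -> : eta * (l k.+1 * h k.+1) = eta * ((l k.+1 + l k.+1) * (h k.+1 + h k.+1))
   - 3 * (eta * (l k.+1 * h k.+1)) by ring.
lra.
Qed.

Let next_spec k p :
  ((next k p).1 = p.1 \/ (next k p).1 = p.1 + l k.+1) /\
  ((next k p).2 = p.2 \/ (next k p).2 = p.2 + h k.+1).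
Proof. by rewrite /next; do !case: ifP => _ /=; auto. Qed.

Let s := fix s k := if k is j.+1 then next j (s j) else (x1, y1).

Let next_bounds k p : [/\ p.1 <= (next k p).1, (next k p).1 + l k.+1 <= p.1 + l k,
   p.2 <= (next k p).2 & (next k p).2 + h k.+1 <= p.2 + h k].
Proof.
have lk := l0 k.+1; have hk := h0 k.+1; rewrite [l k]lS [h k]hS.
by have [[->|->] [->|->]] := next_spec k p; split; lra.
Qed.

Let s_inside k : inside k (s k).
Proof.
elim: k => [|k /and4P[a1 a2 a3 a4]].
  by rewrite /inside /= /l /h expr0 !divr1 !lexx /L /H !(addrC x1, addrC y1) !subrK !lexx.
have [b1 b2 b3 b4] := next_bounds k (s k).
by apply/and4P; split => /=; lra.
Qed.

Lemma goursat_bound : normc (rect_integral f x1 x2 y1 y2) <= eta * (L * H).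
Proof.
rewrite leNgt; apply/negP => bad0.
have badk k : bad k (s k).
  elim: k => [|k /bad_next]; last by apply; exact: s_inside.
  by rewrite /bad /II /= /l /h expr0 !divr1 /L /H !(addrC x1, addrC y1) !subrK.
have [p1 hp1] : exists p, forall k, (s k).1 <= p <= (s k).1 + l k.
  apply: nested_point => k; last exact: ltW.
    by have [] := next_bounds k (s k).
  by have [] := next_bounds k (s k).
have [p2 hp2] : exists p, forall k, (s k).2 <= p <= (s k).2 + h k.
  apply: nested_point => k; last exact: ltW.
    by have [] := next_bounds k (s k).
  by have [] := next_bounds k (s k).
pose p : K := Complex p1 p2.
have /df/derivable_estimate[c cP] : in_rect x1 x2 y1 y2 p.
  have /and4P[a1 a2 a3 a4] := s_inside 0%N.
  have /andP[b1 b2] := hp1 0%N; have /andP[b3 b4] := hp2 0%N.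
  by rewrite /in_rect /=; apply/andP; split; apply/andP; split; lra.
pose e := eta * (L * H) / (4 * (L + H) ^+ 2).
have LH0 : 0 < L + H by rewrite addr_gt0.
have e0 : 0 < e by rewrite /e !(divr_gt0, mulr_gt0, exprn_gt0).
have [d d0 dP] := cP e e0.
have [k kd] : exists k, (L + H) / 2 ^+ k < d.
  have kP := archi_boundP (ltW (divr_gt0 LH0 d0)).
  exists (Num.bound ((L + H) / d)).
  rewrite ltr_pdivrMr ?exprn_gt0 // mulrC -ltr_pdivrMr //.
  apply: lt_trans kP _; rewrite -natrX ltr_nat; exact: ltn_expl.
have /and4P[a1 a2 a3 a4] := s_inside k.
have /andP[b1 b2] := hp1 k; have /andP[b3 b4] := hp2 k.
have lk := l0 k; have hk := h0 k.
have lh : l k + h k = (L + H) / 2 ^+ k by rewrite [RHS]mulrDl.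
have ca w : {for w, continuous (fun w : K => - (f p - c * p) + - c * w)}.
  apply: continuousD; first exact: cst_continuous.
  by apply: continuousM; [exact: cst_continuous | exact: cvg_id].
have xx : (s k).1 <= (s k).1 + l k by rewrite lerDl ltW.
have yy : (s k).2 <= (s k).2 + h k by rewrite lerDl ltW.
have cf := inside_cont (s_inside k).
have EI : II k (s k) = rect_integral (fun w => f w + (- (f p - c * p) + - c * w))
    (s k).1 ((s k).1 + l k) (s k).2 ((s k).2 + h k).
  by rewrite (rect_integralD xx yy cf (fun w _ => ca w)) (rect_integral_affine xx yy) addr0.
have /negP[] : ~~ bad k (s k); last exact: badk.
rewrite /bad -leNgt EI.
apply: le_trans (rect_integral_normc_le xx yy (B := e * (l k + h k)) _ _) _.
- move=> w wbd; apply: continuousD; [exact: cf|exact: ca].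
- move=> w /on_bd_in /andP[/andP[c1 c2] /andP[c3 c4]].
  have nw : normc (w - p) <= l k + h k.
    apply: le_trans (normc_le_ReIm _) _; rewrite !cplxE /=.
    by apply: lerD; rewrite ler_norml; apply/andP; split; lra.
  have -> : f w + (- (f p - c * p) + - c * w) = f w - f p - c * (w - p) by ring.
  apply: (le_trans (dP w _)); first by rewrite lh in nw; exact: le_lt_trans kd.
  by rewrite ler_pM2l.
- have kE (a b : R) : a + b - a = b by ring.
  rewrite !kE lh /e /l /h le_eqVlt; apply/orP; left.
  have : L + H != 0 by rewrite gt_eqF.
  have : (2 : R) ^+ k != 0 by rewrite expf_neq0.
  by move: L H (2 ^+ k) => L' H' q q0 LH'; apply/eqP; field; rewrite q0 LH'.
Qed.

End Bisection.

Lemma goursat : rect_integral f x1 x2 y1 y2 = 0.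
Proof.
apply: eq0_normc; apply/eqP; rewrite eq_le normc_ge0 andbT; apply/ler_addgt0Pl => e e0.
have LH : 0 < L * H by rewrite mulr_gt0.
rewrite addr0; have := goursat_bound (divr_gt0 e0 LH).
by rewrite divfK // gt_eqF.
Qed.

End Goursat.

Section Cauchy.
Variable R : realType.
Local Notation K := (Cplx R).
Local Notation Re := (@complex.Re R).
Local Notation Im := (@complex.Im R).
Implicit Types (f g : K -> K) (c z w : K).

Lemma derivable_sub_cst c w : derivable (fun v : K => v - c) w 1.
Proof. by apply: derivableB; [exact: derivable_id | exact: derivable_cst]. Qed.

Lemma derivable_kernel c w : w != c -> derivable (fun v : K => (v - c)^-1) w 1.
Proof. by move=> wc; apply: derivableV; [rewrite subr_eq0|exact: derivable_sub_cst]. Qed.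

Lemma on_bd_neq (x1 x2 y1 y2 : R) z w :
  x1 < Re z -> Re z < x2 -> y1 < Im z -> Im z < y2 ->
  on_bd x1 x2 y1 y2 w -> w != z.
Proof.
move=> a1 a2 a3 a4 /andP[_ wb]; apply: contraTneq wb => ->; rewrite !negb_or.
by rewrite (gt_eqF a1) (lt_eqF a2) (gt_eqF a3) (lt_eqF a4).
Qed.

Section Cut.
Variable q : K -> K.
Implicit Types x y : R.

Lemma cut_left x1 x x2 y1 y2 : x1 < x -> x <= x2 -> y1 < y2 ->
  (forall w, on_bd x1 x2 y1 y2 w -> {for w, continuous q}) ->
  (forall w, in_rect x1 x y1 y2 w -> derivable q w 1) ->
  rect_integral q x1 x2 y1 y2 = rect_integral q x x2 y1 y2.
Proof.
move=> a b c cq dq; rewrite (rect_integral_splitx (ltW a) b (ltW c) cq).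
by rewrite (goursat a c dq) add0r.
Qed.

Lemma cut_right x1 x x2 y1 y2 : x1 <= x -> x < x2 -> y1 < y2 ->
  (forall w, on_bd x1 x2 y1 y2 w -> {for w, continuous q}) ->
  (forall w, in_rect x x2 y1 y2 w -> derivable q w 1) ->
  rect_integral q x1 x2 y1 y2 = rect_integral q x1 x y1 y2.
Proof.
move=> a b c cq dq; rewrite (rect_integral_splitx a (ltW b) (ltW c) cq).
by rewrite (goursat b c dq) addr0.
Qed.

Lemma cut_bottom x1 x2 y1 y y2 : x1 < x2 -> y1 < y -> y <= y2 ->
  (forall w, on_bd x1 x2 y1 y2 w -> {for w, continuous q}) ->
  (forall w, in_rect x1 x2 y1 y w -> derivable q w 1) ->
  rect_integral q x1 x2 y1 y2 = rect_integral q x1 x2 y y2.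
Proof.
move=> a b c cq dq; rewrite (rect_integral_splity (ltW b) c (ltW a) cq).
by rewrite (goursat a b dq) add0r.
Qed.

Lemma cut_top x1 x2 y1 y y2 : x1 < x2 -> y1 <= y -> y < y2 ->
  (forall w, on_bd x1 x2 y1 y2 w -> {for w, continuous q}) ->
  (forall w, in_rect x1 x2 y y2 w -> derivable q w 1) ->
  rect_integral q x1 x2 y1 y2 = rect_integral q x1 x2 y1 y.
Proof.
move=> a b c cq dq; rewrite (rect_integral_splity b (ltW c) (ltW a) cq).
by rewrite (goursat a c dq) addr0.
Qed.

End Cut.

Section Square.
Variables x1 x2 y1 y2 : R.
Variable z : K.
Hypotheses (zx1 : x1 < Re z) (zx2 : Re z < x2) (zy1 : y1 < Im z) (zy2 : Im z < y2).

Let x12 : x1 < x2. Proof. exact: lt_trans zx2. Qed.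
Let y12 : y1 < y2. Proof. exact: lt_trans zy2. Qed.

Lemma on_bd_kernel_cont w : on_bd x1 x2 y1 y2 w ->
  {for w, continuous (fun v : K => (v - z)^-1)}.
Proof.
move=> /(on_bd_neq zx1 zx2 zy1 zy2) wz.
by apply: derivable_continuous; exact: derivable_kernel.
Qed.

(* The imaginary part of [dw / (w - z)] is positive along each of the four sides. *)
Lemma rect_integral_kernel_neq0 : rect_integral (fun w => (w - z)^-1) x1 x2 y1 y2 != 0.
Proof.
have [i1 i2 i3 i4] := citg_bd (ltW x12) (ltW y12) on_bd_kernel_cont.
have sqp (a b : R) : 0 <= a ^+ 2 + b ^+ 2 by rewrite addr_ge0 ?sqr_ge0.
suff : 0 < Im (rect_integral (fun w => (w - z)^-1) x1 x2 y1 y2).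
  by apply: contraTneq => ->; rewrite ltxx.
rewrite /rect_integral !cplxE /= !mul0r !add0r !mul1r.
set r1 := rint _ x1 x2; set r2 := rint _ y1 y2; set r3 := rint _ x1 x2.
set r4 := rint _ y1 y2.
pose m := (Im z - y1) / ((x2 - x1) ^+ 2 + (Im z - y1) ^+ 2).
have zy1' : 0 < Im z - y1 by rewrite subr_gt0.
have m0 : 0 < m by rewrite divr_gt0 // ltr_pwDr ?exprn_gt0 ?sqr_ge0.
have h1 : m * (x2 - x1) <= r1.
  apply: rint_ge; [exact: ltW | by case: i1|] => t /andP[t1 t2].
  rewrite cImV !cplxE /= -mulNr opprB -(sqrrN (y1 - Im z)) opprB.
  have d0 : 0 < (t - Re z) ^+ 2 + (Im z - y1) ^+ 2.
    by rewrite ltr_pwDr ?exprn_gt0 ?sqr_ge0.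
  rewrite /m ler_pM2l // lef_pV2 ?posrE //; last first.
    by rewrite ltr_pwDr ?exprn_gt0 ?sqr_ge0.
  have [u1 u2] : 0 <= x2 - x1 - (t - Re z) /\ 0 <= x2 - x1 + (t - Re z).
    by have [zl zr] := (zx1, zx2); split; lra.
  by rewrite lerD2r -subr_ge0 subr_sqr mulr_ge0.
have h2 : 0 * (y2 - y1) <= r2.
  apply: rint_ge; [exact: ltW | by case: i4|] => t _.
  by rewrite cReV !cplxE /= divr_ge0 // subr_ge0 ltW.
have h3 : r3 <= 0 * (x2 - x1).
  rewrite -(rint_cst 0 (ltW x12)); apply: le_rint; [by case: i2|exact: itg_cst|] => t _.
  by rewrite cImV !cplxE /= oppr_le0 divr_ge0 // subr_ge0 ltW.
have h4 : r4 <= 0 * (y2 - y1).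
  rewrite -(rint_cst 0 (ltW y12)); apply: le_rint; [by case: i3|exact: itg_cst|] => t _.
  by rewrite cReV !cplxE /= mulr_le0_ge0 ?invr_ge0 // subr_le0 ltW.
have : 0 < m * (x2 - x1) by rewrite mulr_gt0 // subr_gt0.
lra.
Qed.

Lemma cauchy_rect g : (forall w, in_rect x1 x2 y1 y2 w -> derivable g w 1) ->
  rect_integral (fun w => (w - z)^-1 * g w) x1 x2 y1 y2 =
  g z * rect_integral (fun w => (w - z)^-1) x1 x2 y1 y2.
Proof.
have [zl zr zb zt] : [/\ x1 < Re z, Re z < x2, y1 < Im z & Im z < y2] by [].
move=> dg; pose q w := (w - z)^-1 * (g w - g z).
have dq w : in_rect x1 x2 y1 y2 w -> w != z -> derivable q w 1.
  move=> /dg dgw wz; apply: derivableM; first exact: derivable_kernel.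
  exact: (@derivableB _ _ _ g (cst (g z)) w 1 dgw (@derivable_cst _ _ _ _ _ _)).
have cq w : in_rect x1 x2 y1 y2 w -> w != z -> {for w, continuous q}.
  by move=> ? ?; apply: derivable_continuous; exact: dq.
have cg w : on_bd x1 x2 y1 y2 w -> {for w, continuous g}.
  by move=> /on_bd_in ?; apply: derivable_continuous; exact: dg.
have ckg w : on_bd x1 x2 y1 y2 w -> {for w, continuous (fun w => (w - z)^-1 * g w)}.
  by move=> wb; apply: continuousM; [exact: on_bd_kernel_cont | exact: cg].
have ck2 w : on_bd x1 x2 y1 y2 w -> {for w, continuous (fun w => - g z * (w - z)^-1)}.
  by move=> wb; apply: continuousM; [exact: cst_continuous | exact: on_bd_kernel_cont].
suff : rect_integral q x1 x2 y1 y2 = 0.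
  rewrite (_ : rect_integral q _ _ _ _ = rect_integral (fun w => (w - z)^-1 * g w +
    (- g z * (w - z)^-1)) x1 x2 y1 y2); last first.
    by apply: eq_rectI; [exact: ltW|exact: ltW|] => w _; rewrite /q; ring.
  rewrite (rect_integralD (ltW x12) (ltW y12) ckg ck2).
  rewrite (rect_integralZ (ltW x12) (ltW y12) _ on_bd_kernel_cont) mulNr => /subr0_eq.
  exact.
have /derivable_estimate[l /(_ 1 ltr01)[d d0 dP]] : derivable g z 1.
  by apply: dg; rewrite /in_rect !ltW.
pose B := normc l + 1.
have B0 : 0 < B by rewrite ltr_pwDr // normc_ge0.
have qB w : w != z -> normc (w - z) < d -> normc (q w) <= B.
  move=> wz wd; have wz0 : 0 < normc (w - z) by rewrite normc_gt0 subr_eq0.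
  rewrite /q normcM normcV mulrC ler_pdivrMr //.
  have := normc_triangle (g w - g z - l * (w - z)) (l * (w - z)).
  rewrite subrK normcM => /le_trans; apply.
  by rewrite mulrDl addrC lerD2l; exact: dP.
have small (s : R) : 0 < s -> s + s < d -> x1 < Re z - s -> Re z + s < x2 ->
    y1 < Im z - s -> Im z + s < y2 ->
    normc (rect_integral q x1 x2 y1 y2) <= 16 * B * s.
  move=> s0 sd a1 a2 a3 a4.
  have e1 : x1 <= Re z - s by exact: ltW.
  have e2 : Re z + s <= x2 by exact: ltW.
  have e3 : y1 <= Im z - s by exact: ltW.
  have e4 : Im z + s <= y2 by exact: ltW.
  have sub u1 u2 v1 v2 w : x1 <= u1 -> u2 <= x2 -> y1 <= v1 -> v2 <= y2 ->
      in_rect u1 u2 v1 v2 w -> in_rect x1 x2 y1 y2 w.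
    move=> f1 f2 f3 f4 /andP[/andP[b1 b2] /andP[b3 b4]]; rewrite /in_rect.
    by rewrite (le_trans f1) ?(le_trans b2) ?(le_trans f3) ?(le_trans b4).
  have -> : rect_integral q x1 x2 y1 y2 =
      rect_integral q (Re z - s) (Re z + s) (Im z - s) (Im z + s).
    have inq u1 u2 v1 v2 w : x1 <= u1 -> u2 <= x2 -> y1 <= v1 -> v2 <= y2 ->
        u1 < Re z -> Re z < u2 -> v1 < Im z -> Im z < v2 ->
        on_bd u1 u2 v1 v2 w -> {for w, continuous q}.
      move=> f1 f2 f3 f4 g1 g2 g3 g4 wb.
      by apply: cq; [exact: sub (on_bd_in wb) | exact: on_bd_neq wb].
    have out u1 u2 v1 v2 w : x1 <= u1 -> u2 <= x2 -> y1 <= v1 -> v2 <= y2 ->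
        [|| Re z < u1, u2 < Re z, Im z < v1 | v2 < Im z] ->
        in_rect u1 u2 v1 v2 w -> derivable q w 1.
      move=> f1 f2 f3 f4 zo wi; apply: dq; first exact: sub wi.
      apply: contraTneq wi => ->; rewrite /in_rect !negb_and -!ltNge.
      by case/or4P: zo => ->; rewrite ?orbT.
    transitivity (rect_integral q (Re z - s) x2 y1 y2).
      apply: cut_left; [lra | lra | lra | |] => w.
        by apply: inq; lra.
      by apply: out; try lra; apply/or4P; apply: Or42; lra.
    transitivity (rect_integral q (Re z - s) (Re z + s) y1 y2).
      apply: cut_right; [lra | lra | lra | |] => w.
        by apply: inq; lra.
      by apply: out; try lra; apply/or4P; apply: Or41; lra.
    transitivity (rect_integral q (Re z - s) (Re z + s) (Im z - s) y2).
      apply: cut_bottom; [lra | lra | lra | |] => w.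
        by apply: inq; lra.
      by apply: out; try lra; apply/or4P; apply: Or44; lra.
    apply: cut_top; [lra | lra | lra | |] => w.
      by apply: inq; lra.
    by apply: out; try lra; apply/or4P; apply: Or43; lra.
  have bdz w : on_bd (Re z - s) (Re z + s) (Im z - s) (Im z + s) w -> w != z.
    by apply: on_bd_neq; lra.
  apply: le_trans (rect_integral_normc_le (B := B) _ _ _ _) _; first by lra.
  - by lra.
  - move=> w wb; apply: cq; last exact: bdz.
    exact: sub (on_bd_in wb).
  - move=> w wb; apply: qB; first exact: bdz.
    move: (on_bd_in wb) => /andP[/andP[b1 b2] /andP[b3 b4]].
    apply: le_lt_trans (normc_le_ReIm _) _; apply: le_lt_trans sd.
    by apply: lerD; rewrite !cplxE ler_norml; apply/andP; split; lra.
  - rewrite le_eqVlt; apply/orP; left; apply/eqP; ring.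
apply: eq0_normc; apply/eqP; rewrite eq_le normc_ge0 andbT; apply/ler_addgt0Pl => e e0.
rewrite addr0.
pose s := Num.min (e / (16 * B)) (Num.min (d / 3) (Num.min
  (Num.min ((Re z - x1) / 2) ((x2 - Re z) / 2))
  (Num.min ((Im z - y1) / 2) ((y2 - Im z) / 2)))).
have s0 : 0 < s.
  by rewrite !lt_min !divr_gt0 ?mulr_gt0 ?subr_gt0.
have : s <= s by [].
rewrite {2}/s !le_min => /and5P[se sd].
move=> /andP[f1 f2] f3 f4.
apply: le_trans (small s s0 _ _ _ _ _) _; try lra.
by rewrite mulrC -ler_pdivlMr // mulr_gt0.
Qed.

End Square.
End Cauchy.

Section UniqueContinuation.
Variable R : realType.
Local Notation K := (Cplx R).
Local Notation Re := (@complex.Re R).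
Local Notation Im := (@complex.Im R).
Implicit Types (h : K -> K) (c z w : K).

Lemma derivable_kernelX c w n : w != c ->
  derivable (fun v : K => (v - c)^-1 ^+ n) w 1.
Proof.
move=> wc; rewrite (_ : (fun v => _) = (fun v : K => (v - c)^-1) ^+ n).
  exact: derivableX (derivable_kernel wc).
by apply/funext => v; rewrite fctE.
Qed.

Lemma normcX w n : normc (w ^+ n) = normc w ^+ n.
Proof. by elim: n => [|n IH]; rewrite ?expr0 ?normc1 // !exprS normcM IH. Qed.

Lemma geometric_le0 (a C t : R) : 0 <= t < 1 -> (forall n, a <= C * t ^+ n) -> a <= 0.
Proof.
move=> /andP[t0 t1] aC; rewrite leNgt; apply/negP => a0.
have C0 : 0 < C by have := aC 0%N; rewrite expr0 mulr1; exact: lt_le_trans.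
have : (fun n => t ^+ n) @ \oo --> (0 : R) by apply: cvg_expr; rewrite ger0_norm.
move=> /cvgrPdist_lt /(_ (a / C) (divr_gt0 a0 C0)) [n _ /(_ n (leqnn n))].
rewrite /= sub0r normrN ger0_norm ?exprn_ge0 // ltr_pdivlMr // mulrC.
by rewrite ltNge aC.
Qed.

(* Dividing [h] by [(w - c) ^+ n] keeps it differentiable, as it vanishes near
   [c]; Cauchy's formula then bounds [h z] by a multiple of
   [(|z - c| / rho) ^+ n], for every [n]. *)
Lemma unique_continuation h c (r eps : R) : 0 < eps ->
  (forall w, normc (w - c) < r -> derivable h w 1) ->
  (forall w, normc (w - c) < eps -> h w = 0) ->
  forall z, normc (z - c) < r / 3 -> h z = 0.
Proof.
move=> eps0 dh h0 z zc; set rho := r / 3 in zc.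
have hc : h c = 0 by apply: h0; rewrite subrr normc0.
have rho0 : 0 < rho by apply: le_lt_trans zc; exact: normc_ge0.
have rE : r = rho + rho + rho by rewrite /rho; field.
clearbody rho.
have [z1 z2] : `|Re z - Re c| < rho /\ `|Im z - Im c| < rho.
  split; apply: le_lt_trans zc.
    by have := Re_le_normc (z - c); rewrite !cplxE.
  by have := Im_le_normc (z - c); rewrite !cplxE.
move: z1 z2; rewrite !ltr_norml => /andP[z1 z2] /andP[z3 z4].
have i1 : Re c - rho < Re z by lra.
have i2 : Re z < Re c + rho by lra.
have i3 : Im c - rho < Im z by lra.
have i4 : Im z < Im c + rho by lra.
have l12 : Re c - rho <= Re c + rho by lra.
have m12 : Im c - rho <= Im c + rho by lra.
pose bd := on_bd (Re c - rho) (Re c + rho) (Im c - rho) (Im c + rho).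
have dhQ w : in_rect (Re c - rho) (Re c + rho) (Im c - rho) (Im c + rho) w ->
    derivable h w 1.
  move=> /andP[/andP[a1 a2] /andP[a3 a4]]; apply: dh.
  apply: le_lt_trans (normc_le_ReIm _) _; rewrite !cplxE.
  have e1 : `|Re w - Re c| <= rho by rewrite ler_norml; apply/andP; split; lra.
  have e2 : `|Im w - Im c| <= rho by rewrite ler_norml; apply/andP; split; lra.
  by lra.
have bdc w : bd w -> rho <= normc (w - c).
  move=> /andP[_ /or4P[]/eqP e].
  - apply: le_trans (Re_le_normc _); rewrite !cplxE e.
    by rewrite addrC addKr normrN ger0_norm // ltW.
  - apply: le_trans (Re_le_normc _); rewrite !cplxE e.
    by rewrite addrC addKr ger0_norm // ltW.
  - apply: le_trans (Im_le_normc _); rewrite !cplxE e.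
    by rewrite addrC addKr normrN ger0_norm // ltW.
  - apply: le_trans (Im_le_normc _); rewrite !cplxE e.
    by rewrite addrC addKr ger0_norm // ltW.
pose g n w := ((w - c)^-1) ^+ n * h w.
have dg n w : in_rect (Re c - rho) (Re c + rho) (Im c - rho) (Im c + rho) w ->
    derivable (g n) w 1.
  move=> wQ; have [->|wc] := eqVneq w c.
    apply: (@near_eq_derivable _ _ _ (cst 0)); last exact: derivable_cst.
    apply/nbhs_normcP; exists eps => // v vc.
    by rewrite /g h0 // mulr0.
  by apply: derivableM; [exact: derivable_kernelX | exact: dhQ].
have [M hM] := bd_bounded l12 m12
  (fun w wb => derivable_continuous (dhQ w (on_bd_in wb))).
have [N kN] := bd_bounded l12 m12 (on_bd_kernel_cont i1 i2 i3 i4).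
have kk := rect_integral_kernel_neq0 i1 i2 i3 i4.
set k := rect_integral _ _ _ _ _ in kk.
have k0 : 0 < normc k by rewrite normc_gt0.
have [->//|zc0] := eqVneq z c.
have nz0 : 0 < normc (z - c) by rewrite normc_gt0 subr_eq0.
have key n : normc (h z) * normc k <=
    (4 * (N * M) * (rho + rho + (rho + rho))) * (normc (z - c) / rho) ^+ n.
  have B : normc (g n z * k) <=
      4 * (N * (rho ^- n * M)) * (rho + rho + (rho + rho)).
    rewrite -(cauchy_rect i1 i2 i3 i4 (dg n)).
    have -> : rho + rho + (rho + rho) =
        Re c + rho - (Re c - rho) + (Im c + rho - (Im c - rho)) by ring.
    apply: rect_integral_normc_le => // w wb.
      apply: continuousM; first exact: (on_bd_kernel_cont i1 i2 i3 i4 wb).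
      exact: derivable_continuous (dg n w (on_bd_in wb)).
    rewrite normcM; apply: ler_pM; [exact: normc_ge0 | exact: normc_ge0 | exact: kN |].
    rewrite normcM; apply: ler_pM; [exact: normc_ge0 | exact: normc_ge0 | | exact: hM].
    rewrite normcX normcV exprVn lef_pV2 ?posrE ?exprn_gt0 //; last first.
      exact: lt_le_trans rho0 (bdc w wb).
    by rewrite lerXn2r ?nnegrE ?normc_ge0 ?(ltW rho0) //; exact: bdc.
  rewrite normcM normcM normcX normcV in B.
  have zn0 : 0 < normc (z - c) ^+ n by rewrite exprn_gt0.
  rewrite -(ler_pM2l zn0) in B.
  rewrite exprVn -!mulrA mulVKf ?gt_eqF // in B.
  apply: le_trans B _; rewrite le_eqVlt expr_div_n; apply/orP; left; apply/eqP.
  by move: (normc (z - c) ^+ n) ((rho ^+ n)^-1) => u v; ring.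
have t1 : 0 <= normc (z - c) / rho < 1.
  by rewrite divr_ge0 ?normc_ge0 ?ltW //= ltr_pdivrMr // mul1r.
have := geometric_le0 t1 key; rewrite pmulr_lle0 // => hz.
by apply: eq0_normc; apply/eqP; rewrite eq_le hz normc_ge0.
Qed.

End UniqueContinuation.

(** * Diagonal dominance and Schur complements *)

Section DiagonalDominance.
Variable F : numFieldType.

Definition radius m (Z : 'M[F]_m) (i : 'I_m) : F := \sum_(j < m | j != i) `|Z i j|.

Definition gersh_cond m (Z : 'M[F]_m) : Prop :=
  exists i : 'I_m, `|Z i i| <= radius Z i.

Definition brauer_cond m (Z : 'M[F]_m) : Prop :=
  exists i k : 'I_m, (i < k)%N /\ `|Z i i * Z k k| <= radius Z i * radius Z k.

Lemma radius_ge0 m (Z : 'M[F]_m) i : 0 <= radius Z i.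
Proof. by apply: sumr_ge0. Qed.

Lemma brauer_cond_intro m (Z : 'M[F]_m) i k : i != k ->
  `|Z i i| * `|Z k k| <= radius Z i * radius Z k -> brauer_cond Z.
Proof.
move=> ik h; case: (ltngtP i k) => [ltik|ltki|/val_inj e]; last by rewrite e eqxx in ik.
  by exists i, k; rewrite normrM.
by exists k, i; rewrite normrM mulrC [X in _ <= X]mulrC.
Qed.

Lemma row_bound m (Z : 'M[F]_m) (v : 'cV_m) q b : (Z *m v) q 0 = 0 ->
  (forall j, j != q -> `|v j 0| <= b) -> `|Z q q| * `|v q 0| <= radius Z q * b.
Proof.
rewrite mxE (bigD1 q) //= => /eqP; rewrite addr_eq0 => /eqP e vb.
rewrite -normrM e normrN /radius mulr_suml; apply: le_trans (ler_norm_sum _ _ _) _.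
by apply: ler_sum => j jq; rewrite normrM ler_wpM2l // vb.
Qed.

Lemma gersh_cond_intro m (Z : 'M[F]_m) (v : 'cV_m) q : (Z *m v) q 0 = 0 ->
  v q 0 != 0 -> (forall j, `|v j 0| <= `|v q 0|) -> `|Z q q| <= radius Z q.
Proof.
move=> Zv vq vmax; rewrite -(ler_pM2r (x := `|v q 0|)) ?normr_gt0 //.
exact: row_bound.
Qed.

Lemma brauer_pair m (Z : 'M[F]_m) (v : 'cV_m) p q : p != q ->
  (Z *m v) p 0 = 0 -> (Z *m v) q 0 = 0 -> v p 0 != 0 ->
  (forall j, j != p -> `|v j 0| <= `|v q 0|) ->
  (forall j, `|v j 0| <= `|v p 0|) -> brauer_cond Z.
Proof.
move=> pq Zp Zq vp vq vmax; apply: (brauer_cond_intro pq).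
have hp := row_bound Zp vq.
have hq : `|Z q q| * `|v q 0| <= radius Z q * `|v p 0| by apply: row_bound.
have vp0 : 0 < `|v p 0| by rewrite normr_gt0.
have [vq0|vq0] := eqVneq (v q 0) 0.
  move: hp; rewrite vq0 normr0 mulr0 pmulr_lle0 // normr_le0 => /eqP ->.
  by rewrite normr0 mul0r mulr_ge0 ?radius_ge0.
have vq0' : 0 < `|v q 0| by rewrite normr_gt0.
rewrite -(ler_pM2r (mulr_gt0 vp0 vq0')) mulrACA.
rewrite [X in _ <= _ * X]mulrC [X in _ <= X]mulrACA.
by apply: ler_pM => //; rewrite mulr_ge0.
Qed.

Lemma norm_argmax m (v : 'cV[F]_m) (Q : pred 'I_m) i0 : Q i0 ->
  exists2 q, Q q & forall j, Q j -> `|v j 0| <= `|v q 0|.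
Proof.
move=> Qi0; have nr : {in Q, forall i, `|v i 0| \is Num.real}.
  by move=> i _; exact: normr_real.
by case: (real_arg_maxP Qi0 nr) => q Qq qmax; exists q.
Qed.

Lemma singular_vector m (Z : 'M[F]_m) : \det Z = 0 ->
  exists2 v : 'cV_m, v != 0 & Z *m v = 0.
Proof.
move=> dZ; have /eqP/det0P[u u0 uZ] : \det Z^T = 0 by rewrite det_tr.
exists u^T; first by rewrite -(inj_eq trmx_inj) trmxK trmx0.
by apply: trmx_inj; rewrite trmx_mul trmxK uZ trmx0.
Qed.

Lemma max_entry m (v : 'cV[F]_m) : v != 0 ->
  exists2 p, v p 0 != 0 & forall j, `|v j 0| <= `|v p 0|.
Proof.
move=> /cV0Pn[i vi]; have [p _ pmax] := @norm_argmax m v predT i isT.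
exists p; last by move=> j; exact: pmax.
by rewrite -normr_gt0 (lt_le_trans _ (pmax i isT)) // normr_gt0.
Qed.

Lemma gershgorin_singular m (Z : 'M[F]_m) : \det Z = 0 -> gersh_cond Z.
Proof.
move=> /singular_vector[v /max_entry[p vp pmax] Zv]; exists p.
by apply: (gersh_cond_intro _ vp) => //; rewrite Zv mxE.
Qed.

Lemma brauer_singular m (Z : 'M[F]_m.+2) : \det Z = 0 -> brauer_cond Z.
Proof.
move=> /singular_vector[v /max_entry[p vp pmax] Zv].
have [i0 i0p] : exists i0 : 'I_m.+2, i0 != p.
  exists (if p == ord0 then ord_max else ord0).
  by case: ifP => [/eqP ->|/negbT] //; rewrite eq_sym.
have [q qp qmax] := @norm_argmax _ v (fun j => j != p) i0 i0p.
by apply: (@brauer_pair _ _ v p q) => //; rewrite ?Zv ?mxE // eq_sym.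
Qed.

Lemma row_annihilator m (S : 'M[F]_m) i t : 0 <= t -> `|S i i| <= t * radius S i ->
  exists y : 'cV_m, [/\ y i 0 = 1, forall j, j != i -> `|y j 0| <= t &
    (S *m y) i 0 = 0].
Proof.
move=> t0 h; have [Sii|Sii] := eqVneq (S i i) 0.
  exists (delta_mx i 0); split=> [|j ji|].
  - by rewrite mxE !eqxx.
  - by rewrite mxE (negbTE ji) normr0.
  - rewrite mxE (bigD1 i) //= Sii mul0r add0r big1 // => j ji.
    by rewrite mxE (negbTE ji) mulr0.
have T0 : 0 < radius S i.
  rewrite lt_neqAle radius_ge0 andbT eq_sym; apply: contraNneq Sii => T0.
  by move: h; rewrite T0 mulr0 normr_le0.
pose y := \col_j (if j == i then 1 else - (S i i / radius S i) * (`|S i j| / S i j)).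
exists y; split=> [|j ji|].
- by rewrite mxE eqxx.
- rewrite mxE (negbTE ji) normrM normrN normrM (normfV (radius _ _)).
  rewrite (ger0_norm (ltW T0)).
  have [->|Sij] := eqVneq (S i j) 0; first by rewrite invr0 mulr0 normr0 mulr0.
  by rewrite normrM normr_id normfV divff ?normr_eq0 // mulr1 ler_pdivrMr.
- rewrite mxE (bigD1 i) //= mxE eqxx mulr1.
  rewrite (eq_bigr (fun j => - (S i i / radius S i) * `|S i j|)); last first.
    move=> j ji; rewrite mxE (negbTE ji) mulrCA; congr (_ * _).
    have [->|Sij] := eqVneq (S i j) 0; first by rewrite normr0 mul0r.
    by rewrite mulrC divfK.
  by rewrite -mulr_sumr -/(radius S i) mulNr divfK ?gt_eqF // subrr.
Qed.

End DiagonalDominance.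

Section SchurComplement.
Variable F : numFieldType.
Variables n s : nat.
Variables (A P : 'M[F]_n.+1) (B : 'M[F]_(n.+1, s.+1)).
Variables (C : 'M[F]_(s.+1, n.+1)) (E : 'M[F]_s.+1) (al : F).
Hypothesis PA : P *m A = al%:M.

Let M := block_mx A B C E.
Let S := al *: E - C *m P *m B.

Lemma det_schur : \det M = 0 -> \det A != 0 -> \det S = 0.
Proof.
move=> dM dA; have uA : A \in unitmx by rewrite unitmxE unitfE.
have PE : P = al *: invmx A.
  by rewrite -[P]mulmx1 -(mulmxV uA) mulmxA PA mul_scalar_mx.
have SE : S = al *: (E - C *m invmx A *m B).
  by rewrite /S PE scalerBr -scalemxAr -scalemxAl.
have ME : M = block_mx A 0 C 1%:M *m
    block_mx 1%:M (invmx A *m B) 0 (E - C *m invmx A *m B).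
  rewrite mulmx_block !mulmx1 !mul1mx !mul0mx ?mulmx0 !addr0 mulmxA mulmxV //.
  by rewrite mul1mx mulmxA addrCA subrr addr0.
move: dM; rewrite ME det_mulmx det_lblock det_ublock !det1 mulr1 mul1r.
by move=> /eqP; rewrite mulf_eq0 (negbTE dA) SE detZ => /eqP ->; rewrite mulr0.
Qed.

Hypothesis al0 : al != 0.

Lemma schur_detA : \det A != 0.
Proof.
apply/eqP => dA; have := congr1 determinant PA.
rewrite det_mulmx dA mulr0 det_scalar => /esym/eqP.
by rewrite expf_eq0 (negbTE al0) andbF.
Qed.

Let AP : A *m P = al%:M.
Proof.
have : al^-1 *: P *m A = 1%:M by rewrite -scalemxAl PA scale_scalar_mx mulVf.
move=> /mulmx1C; rewrite -scalemxAr => e.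
by rewrite -[LHS](scalerKV al0) e scale_scalar_mx mulr1.
Qed.

Let lift y : 'cV_(n.+1 + s.+1) := col_mx (- al^-1 *: (P *m B *m y)) y.

Let lift_l y k : lift y (lshift _ k) 0 = (- al^-1 *: (P *m B *m y)) k 0.
Proof. by rewrite col_mxEu. Qed.
Let lift_r y k : lift y (rshift _ k) 0 = y k 0.
Proof. by rewrite col_mxEd. Qed.

Let M_lift y : M *m lift y = col_mx 0 (al^-1 *: (S *m y)).
Proof.
rewrite mul_block_col; congr col_mx.
  rewrite -scalemxAr !mulmxA AP mul_scalar_mx -scalemxAl scalerA mulNr mulVf //.
  by rewrite scaleN1r addNr.
rewrite /S mulmxBl scalerBr -!scalemxAl scalerA mulVf // scale1r addrC.
by rewrite -scalemxAr scaleNr !mulmxA.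
Qed.

Let M_lift_l y k : (M *m lift y) (lshift _ k) 0 = 0.
Proof. by rewrite M_lift col_mxEu mxE. Qed.
Let M_lift_r y k : (S *m y) k 0 = 0 -> (M *m lift y) (rshift _ k) 0 = 0.
Proof. by move=> Sy; rewrite M_lift col_mxEd mxE Sy mulr0. Qed.

Let top_max y : exists q : 'I_n.+1, forall k,
  `|lift y (lshift _ k) 0| <= `|lift y (lshift _ q) 0|.
Proof.
have [q _ qmax] := @norm_argmax F _ (- al^-1 *: (P *m B *m y)) predT ord0 isT.
by exists q => k; rewrite !lift_l qmax.
Qed.

Lemma gersh_schur : gersh_cond S -> gersh_cond M.
Proof.
move=> [i Si].
have [|y [yi yj Sy]] := @row_annihilator _ _ S i 1 ler01; first by rewrite mul1r.
have [q qmax] := top_max y.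
have y1 j : `|lift y (rshift _ j) 0| <= 1.
  by rewrite lift_r; have [->|/yj//] := eqVneq j i; rewrite yi normr1.
have [q1|q1] := real_leP (normr_real (lift y (lshift _ q) 0)) (@real1 F).
  exists (rshift _ i); apply: (@gersh_cond_intro _ _ _ (lift y)) => [||j].
  - exact: M_lift_r.
  - by rewrite lift_r yi oner_eq0.
  - have -> : lift y (rshift _ i) 0 = 1 by rewrite lift_r.
    rewrite normr1; case: (split_ordP j) => k -> //.
    exact: le_trans (qmax k) q1.
exists (lshift _ q); apply: (@gersh_cond_intro _ _ _ (lift y)) => [||j].
- exact: M_lift_l.
- by rewrite -normr_gt0 (lt_trans _ q1).
- case: (split_ordP j) => k -> //.
  exact: le_trans (y1 k) (ltW q1).
Qed.

Let brauer_schur_row i k : i != k -> `|S i i| <= radius S i ->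
  `|S i i| * `|S k k| <= radius S i * radius S k -> brauer_cond M.
Proof.
move=> ik Si Sik; pose tau := `|S i i| / radius S i.
have tau0 : 0 <= tau by rewrite divr_ge0 ?radius_ge0.
have tauE : `|S i i| = tau * radius S i.
  have [r0|r0] := eqVneq (radius S i) 0; last by rewrite /tau divfK.
  by move: Si; rewrite r0 mulr0 normr_le0 => /eqP ->; rewrite normr0.
have tau1 : tau <= 1.
  have [r0|r0] := eqVneq (radius S i) 0; first by rewrite /tau r0 invr0 mulr0.
  by rewrite ler_pdivrMr ?mul1r // lt_neqAle eq_sym r0 radius_ge0.
have [|y [yi yj Sy]] := @row_annihilator _ _ S i tau tau0; first by rewrite tauE.
have [q qmax] := top_max y.
have vi : lift y (rshift _ i) 0 = 1 by rewrite lift_r.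
have rl a b : rshift n.+1 a != lshift s.+1 b :> 'I_(n.+1 + s.+1) by rewrite eq_rlshift.
have y1 j : `|lift y (rshift _ j) 0| <= 1.
  by rewrite lift_r; have [->|/yj/le_trans->//] := eqVneq j i; rewrite yi normr1.
have [q1|q1] := real_leP (normr_real (lift y (lshift _ q) 0)) (@real1 F); last first.
  have vq0 : lift y (lshift _ q) 0 != 0 by rewrite -normr_gt0 (lt_trans _ q1).
  have qall j : `|lift y j 0| <= `|lift y (lshift _ q) 0|.
    by case: (split_ordP j) => l -> //; exact: le_trans (y1 l) (ltW q1).
  have [m mq mmax] := @norm_argmax F _ (lift y) (fun j => j != lshift _ q) _ (rl i q).
  case: (split_ordP m) => l ml; rewrite {}ml in mq mmax.
    apply: (@brauer_pair _ _ _ (lift y) (lshift _ q) (lshift _ l)) => //;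
      by rewrite 1?eq_sym ?M_lift_l.
  apply: (@brauer_pair _ _ _ (lift y) (lshift _ q) (rshift _ i)) => //.
  - by rewrite eq_sym rl.
  - exact: M_lift_r.
  - by move=> j /mmax jl; apply: le_trans jl _; rewrite vi normr1.
have [qt|qt] := real_leP (ger0_real tau0) (normr_real (lift y (lshift _ q) 0)).
  apply: (@brauer_pair _ _ _ (lift y) (rshift _ i) (lshift _ q)) => //.
  - exact: M_lift_r.
  - by rewrite vi oner_eq0.
  - move=> j; case: (split_ordP j) => l -> // li.
    apply: le_trans qt; rewrite lift_r yj //.
    by apply: contraNneq li => ->.
  - move=> j; rewrite vi normr1; case: (split_ordP j) => l -> //.
    exact: le_trans (qmax l) q1.
have tau_gt0 : 0 < tau by apply: le_lt_trans qt.
have Mi : `|M (rshift _ i) (rshift _ i)| <= radius M (rshift _ i) * tau.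
  rewrite -[X in X <= _]mulr1 -[X in _ * X <= _](normr1 F) -vi.
  apply: row_bound; first exact: M_lift_r.
  move=> j; case: (split_ordP j) => l -> li; first exact: le_trans (qmax l) (ltW qt).
  by rewrite lift_r yj //; apply: contraNneq li => ->.
have [||y' [yk' yj' Sy']] := @row_annihilator _ _ S k tau^-1.
- by rewrite invr_ge0.
- rewrite mulrC ler_pdivlMr // mulrC.
  have r0 : 0 < radius S i.
    rewrite lt_neqAle eq_sym radius_ge0 andbT.
    by apply: contraTneq tau_gt0 => r0; rewrite /tau r0 invr0 mulr0 ltxx.
  by rewrite -(ler_pM2l r0) mulrA [_ * tau]mulrC -tauE.
have tauV1 : 1 <= tau^-1 by rewrite invf_ge1.
have [q' qmax'] := top_max y'.
have y1' j : `|lift y' (rshift _ j) 0| <= tau^-1.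
  by rewrite lift_r; have [->|/yj'//] := eqVneq j k; rewrite yk' normr1.
have vk : lift y' (rshift _ k) 0 = 1 by rewrite lift_r.
have [q1'|q1'] := real_leP (normr_real (lift y' (lshift _ q') 0))
    (ger0_real (le_trans ler01 tauV1)).
  have Mk : `|M (rshift _ k) (rshift _ k)| <= radius M (rshift _ k) * tau^-1.
    rewrite -[X in X <= _]mulr1 -[X in _ * X <= _](normr1 F) -vk.
    apply: row_bound; first exact: M_lift_r.
    move=> j _; case: (split_ordP j) => l -> //; exact: le_trans (qmax' l) q1'.
  apply: (@brauer_cond_intro _ _ _ (rshift _ i) (rshift _ k)).
    by rewrite eq_rshift.
  apply: le_trans (ler_pM _ _ Mi Mk) _ => //.
  by rewrite mulrACA divff ?mulr1 // gt_eqF.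
have Mq : `|M (lshift _ q') (lshift _ q')| <= radius M (lshift _ q').
  apply: (@gersh_cond_intro _ _ _ (lift y')) => [||j].
  - exact: M_lift_l.
  - by rewrite -normr_gt0 (lt_trans _ q1') // invr_gt0.
  - case: (split_ordP j) => l -> //; exact: le_trans (y1' l) (ltW q1').
apply: (@brauer_cond_intro _ _ _ (rshift _ i) (lshift _ q')) => //.
apply: ler_pM => //; apply: le_trans Mi _.
by rewrite -[X in _ <= X]mulr1 ler_wpM2l ?radius_ge0.
Qed.

Lemma brauer_schur : brauer_cond S -> brauer_cond M.
Proof.
move=> [i [k [ltik h]]]; rewrite normrM in h.
have ik : i != k by apply: contraTneq ltik => ->; rewrite ltnn.
have rr j : radius S j \is Num.real by rewrite ger0_real ?radius_ge0.
have [Si|Si] := real_leP (normr_real (S i i)) (rr i).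
  exact: (brauer_schur_row ik).
have [Sk|Sk] := real_leP (normr_real (S k k)) (rr k).
  by apply: (@brauer_schur_row k i); rewrite 1?eq_sym // mulrC [X in _ <= X]mulrC.
have : radius S i * radius S k < `|S i i| * `|S k k|.
  by apply: ltr_pM; rewrite ?radius_ge0.
by move=> /lt_le_trans /(_ h); rewrite ltxx.
Qed.

End SchurComplement.

Lemma ppoly_mul (F : comNzRingType) n (f : F) (Z : 'M[F]_n.+1) (a : {poly F}) :
  ppoly f Z a *m (f%:M - Z) = a.[f]%:M - horner_mx Z a.
Proof.
have tel k : (\sum_(1 <= i < k.+1) f ^+ (i - 1) *: Z ^+ (k - i)) *m (f%:M - Z) =
    (f ^+ k)%:M - Z ^+ k.
  pose g i := f ^+ (i - 1) *: Z ^+ (k.+1 - i).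
  rewrite mulmx_suml (eq_big_nat _ _ (F2 := fun i => g i.+1 - g i)).
    by rewrite telescope_sumr // /g subn1 subnn subn1 !expr0 scale1r scalemx1.
  move=> [//|i] /andP[_ ik]; rewrite /g !subn1 /= !subSS.
  rewrite mulmxBr mul_mx_scalar scalerA -exprS; congr (_ - _).
  by rewrite -scalemxAl -(subSS i k) subSn // exprSr.
have aE : horner_mx Z a = \sum_(0 <= k < size a) a`_k *: Z ^+ k.
  rewrite -[a in LHS]coefK poly_def rmorph_sum /= big_mkord; apply: eq_bigr => k _.
  by rewrite horner_mxZ rmorphXn /= horner_mx_X.
have fE : a.[f]%:M = \sum_(0 <= k < size a) a`_k *: (f ^+ k)%:M :> 'M[F]_n.+1.
  rewrite horner_coef rmorph_sum big_mkord; apply: eq_bigr => k _.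
  by rewrite /= scale_scalar_mx.
rewrite /ppoly mulmx_suml aE fE -sumrB.
case: (posnP (size a)) => [->|a0]; first by rewrite !big_geq.
rewrite [RHS]big_ltn // !expr0 subrr add0r.
by apply: eq_bigr => k _; rewrite -scalemxAl tel scalerBr.
Qed.

(** * Meromorphic functions *)

Section IdentityTheorem.
Variables (R : realType) (D : domain (Cplx R)).
Local Notation K := (Cplx R).
Implicit Types (z w : K) (u g : mero D).

Lemma dnbhs_normcP z (P : K -> Prop) : (\forall w \near z^', P w) <->
  exists2 d : R, 0 < d & forall w, normc (w - z) < d -> w != z -> P w.
Proof.
split=> [/nbhs_normcP[d d0 h]|[d d0 h]].
  by exists d => // w wd wz; apply: h.
by apply/nbhs_normcP; exists d => // w wd wz; apply: h.
Qed.

Let locally_zero u : set K := [set z | \forall w \near z^', mero_repr u w = 0].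

Let locally_zero_open u : open (locally_zero u).
Proof.
rewrite openE => x /dnbhs_normcP[d d0 ux]; apply/nbhs_normcP; exists d => // y yd.
apply/dnbhs_normcP; have [->|yx] := eqVneq y x; first by exists d.
have yx0 : 0 < normc (y - x) by rewrite normc_gt0 subr_eq0.
exists (Num.min (d - normc (y - x)) (normc (y - x))).
  by rewrite lt_min subr_gt0 yd.
move=> w; rewrite lt_min => /andP[w1 w2] wy; apply: ux.
  have := normc_dist w y x; lra.
by apply: contraTneq w2 => ->; rewrite -leNgt normcB.
Qed.

Let locally_zero_closed u z : domain_set D z -> closure (locally_zero u) z ->
  locally_zero u z.
Proof.
move=> Dz clz.
have /asboolP/(_ z Dz) := merofun_valP (repr (u : {ideal_quot dnbhs_null (D:=D)})).
move=> [m [h [/nbhs_normcP[r1 r10 dh] /dnbhs_normcP[r2 r20 uh]]]].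
pose r := Num.min r1 r2.
have r0 : 0 < r by rewrite lt_min r10.
have [p [/dnbhs_normcP[d d0 up] pz]] :
    locally_zero u `&` [set w | normc (w - z) < r / 16] !=set0.
  by apply: clz; apply/nbhs_normcP; exists (r / 16) => //; rewrite divr_gt0.
rewrite /= in pz.
have [<-|pz_neq] := eqVneq p z; first by apply/dnbhs_normcP; exists d.
have pz0 : 0 < normc (p - z) by rewrite normc_gt0 subr_eq0.
pose eta := Num.min d (normc (p - z)).
have eta0 : 0 < eta by rewrite lt_min d0.
have [ed ez] : eta <= d /\ eta <= normc (p - z).
  by rewrite !ge_min !lexx orbT.
pose c : K := p + (eta / 2)%:C%C.
have cp : normc (c - p) = eta / 2.
  by rewrite addrC addKr normc_real ger0_norm // divr_ge0 // ltW.
have rr1 w : normc (w - z) < r -> normc (w - z) < r1.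
  by rewrite lt_min => /andP[].
have rr2 w : normc (w - z) < r -> normc (w - z) < r2.
  by rewrite lt_min => /andP[].
have h0 w : normc (w - c) < eta / 2 -> h w = 0.
  move=> wc.
  have wp : normc (w - p) < eta.
    by have := normc_dist w c p; lra.
  have wz : w != z.
    by apply: contraTneq wp => ->; rewrite -leNgt normcB.
  have wr : normc (w - z) < r.
    by have := normc_dist w p z; lra.
  have := uh w (rr2 w wr) wz.
  rewrite [LHS]up; first 1 last.
  - exact: lt_le_trans wp ed.
  - by apply: contraTneq wc => ->; rewrite -leNgt normcB cp.
  move=> /esym/eqP; rewrite mulf_eq0 invr_eq0 expf_eq0 subr_eq0 (negbTE wz).
  by rewrite andbF orbF => /eqP.
have e20 : 0 < eta / 2 by rewrite divr_gt0.
have dhc v : normc (v - c) < r * 3 / 4 -> derivable h v 1.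
  move=> vc; apply: dh; apply: rr1.
  have := normc_dist v c p; have := normc_dist v p z.
  by rewrite cp; lra.
apply/dnbhs_normcP; exists (r / 8); first by rewrite divr_gt0.
move=> w wr wz.
have hw : h w = 0.
  apply: (unique_continuation e20 dhc h0).
  have := normc_dist w z p; have := normc_dist w p c.
  by rewrite (normcB p c) cp (normcB z p); lra.
have wr2 : normc (w - z) < r2 by apply: rr2; lra.
by rewrite [LHS](uh w wr2 wz) hw mul0r.
Qed.

Lemma mero_not_locally_zero u z : u != 0 -> domain_set D z ->
  ~ \forall w \near z^', mero_repr u w = 0.
Proof.
move=> u0 Dz uz; case/eqP: u0.
have DU : domain_set D `&` locally_zero u = domain_set D.
  apply: (domain_connected (d := D)).
  - by exists z.
  - by exists (locally_zero u); [exact: locally_zero_open|].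
  - exists (closure (locally_zero u)); first exact: closed_closure.
    apply/seteqP; split=> w [Dw lw]; (split; first exact: Dw).
      exact: (subset_closure lw).
    exact: (locally_zero_closed Dw lw).
have : repr (u : {ideal_quot dnbhs_null (D:=D)}) - 0 \in dnbhs_null (D:=D).
  rewrite subr0; apply/asboolP => w Dw.
  by have [] : (domain_set D `&` locally_zero u) w by rewrite DU.
rewrite Quotient.idealrBE reprK => /eqP e.
by rewrite e; exact: (rmorph0 (\pi_({ideal_quot dnbhs_null (D:=D)})%qT)).
Qed.

End IdentityTheorem.

Section LocalRing.
Variables (R : realType) (D : domain (Cplx R)) (z : Cplx R).
Hypothesis Dz : domain_set D z.
Local Notation K := (Cplx R).
Local Notation Q := {ideal_quot dnbhs_null (D:=D)}.
Implicit Types (g u : mero D).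

Lemma mero_repr1 : \forall w \near z^', mero_repr (1 : mero D) w = 1.
Proof.
have -> : (1 : mero D) = \pi_(Q)%qT 1 by rewrite rmorph1.
exact: mero_repr_pi.
Qed.

Lemma mero_reprB g u :
  \forall w \near z^', mero_repr (g - u) w = mero_repr g w - mero_repr u w.
Proof.
have -> : g - u = \pi_(Q)%qT (repr (g : Q) - repr (u : Q)).
  by rewrite rmorphB /= !reprK.
exact: mero_repr_pi.
Qed.

Lemma mero_reprM g u :
  \forall w \near z^', mero_repr (g * u) w = mero_repr g w * mero_repr u w.
Proof.
have -> : g * u = \pi_(Q)%qT (repr (g : Q) * repr (u : Q)).
  by rewrite rmorphM /= !reprK.
exact: mero_repr_pi.
Qed.

Definition holo_germ (g : mero D) (h : K -> K) : Prop :=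
  holomorphic_at h z /\ \forall w \near z^', mero_repr g w = h w.

Lemma holo_germ1 : holo_germ 1 (cst 1).
Proof. by split; [exact: holomorphic_at_cst | exact: mero_repr1]. Qed.

Lemma holo_germB g u hg hu : holo_germ g hg -> holo_germ u hu ->
  holo_germ (g - u) (hg - hu).
Proof.
move=> [hhg gh] [hhu uh]; split.
  exact: (holomorphic_atD hhg (holomorphic_atN hhu)).
by apply: filterS3 (mero_reprB g u) gh uh => w e1 e2 e3; rewrite e1 e2 e3.
Qed.

Lemma holo_germM g u hg hu : holo_germ g hg -> holo_germ u hu ->
  holo_germ (g * u) (hg * hu).
Proof.
move=> [hhg gh] [hhu uh]; split; first exact: (holomorphic_atM hhg hhu).
by apply: filterS3 (mero_reprM g u) gh uh => w e1 e2 e3; rewrite e1 e2 e3.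
Qed.

Definition defined_pred : {pred mero D} := fun g => `[< defined_at g z >].

Lemma defined_pred_subring : subring_closed defined_pred.
Proof.
split.
- by apply/asboolP; exists (cst 1); exact: holo_germ1.
- move=> g u /asboolP[hg gP] /asboolP[hu uP]; apply/asboolP.
  by exists (hg - hu); exact: holo_germB.
- move=> g u /asboolP[hg gP] /asboolP[hu uP]; apply/asboolP.
  by exists (hg * hu); exact: holo_germM.
Qed.

Lemma mero_val_germ g h : holo_germ g h -> mero_val g z = h z.
Proof. by move=> [hh gh]; exact: mero_valE. Qed.

Lemma mero_val1 : mero_val (1 : mero D) z = 1.
Proof. exact: (mero_val_germ holo_germ1). Qed.

Lemma mero_valB g u : defined_at g z -> defined_at u z ->
  mero_val (g - u) z = mero_val g z - mero_val u z.
Proof.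
move=> [hg gP] [hu uP].
by rewrite (mero_val_germ (holo_germB gP uP)) (mero_val_germ gP) (mero_val_germ uP).
Qed.

Lemma mero_valM g u : defined_at g z -> defined_at u z ->
  mero_val (g * u) z = mero_val g z * mero_val u z.
Proof.
move=> [hg gP] [hu uP].
by rewrite (mero_val_germ (holo_germM gP uP)) (mero_val_germ gP) (mero_val_germ uP).
Qed.

Lemma mero_val_mul_eq0 u g : u != 0 -> defined_at g z -> g * u = 0 ->
  mero_val g z = 0.
Proof.
move=> u0 [h gP] gu0; rewrite (mero_val_germ gP); apply: contrapT => /eqP hz.
apply: (mero_not_locally_zero u0 Dz).
have [hh gh] := gP.
have ch : {for z, continuous h}.
  exact: derivable_continuous (nbhs_singleton hh).
have hn0 : \forall w \near z^', h w != 0.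
  have hz0 : 0 < normc (h z) by rewrite normc_gt0.
  have [d d0 hd] := continuous_normc ch hz0.
  apply/dnbhs_normcP; exists d => // w wd _.
  by apply: contraTneq (hd w wd) => ->; rewrite sub0r normc_opp ltxx.
have r0 : \forall w \near z^', mero_repr (g * u) w = 0.
  rewrite gu0 -(subrr (1 : mero D)).
  by apply: filterS (mero_reprB 1 1) => w ->; rewrite subrr.
near=> w.
have e1 : mero_repr (g * u) w = 0 by near: w.
have e2 : mero_repr (g * u) w = mero_repr g w * mero_repr u w.
  by near: w; exact: mero_reprM.
have e3 : mero_repr g w = h w by near: w.
have e4 : h w != 0 by near: w.
by move: e2; rewrite e1 e3 => /esym/eqP; rewrite mulf_eq0 (negbTE e4) => /eqP.
Unshelve. all: by end_near. Qed.

End LocalRing.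

Section HoloRing.
Variables (R : realType) (D : domain (Cplx R)) (z : Cplx R).
Hypothesis Dz : domain_set D z.

(* The proof that [z] lies in [D] is a parameter so that the subring structure
   can be inferred from the predicate. *)
Definition holo_pred of domain_set D z : {pred mero D} := defined_pred z.

HB.instance Definition _ :=
  GRing.isSubringClosed.Build (mero D) (holo_pred Dz) (defined_pred_subring Dz).

Record holo := Holo { holo_val :> mero D; holo_valP : holo_val \in holo_pred Dz }.

HB.instance Definition _ := [isSub for holo_val].
HB.instance Definition _ := [Choice of holo by <:].
HB.instance Definition _ := [SubChoice_isSubComNzRing of holo by <:].

Lemma holo_defined (x : holo) : defined_at (val x) z.
Proof. by apply/asboolP; exact: holo_valP. Qed.

Definition holo_eval (x : holo) : Cplx R := mero_val (val x) z.

Lemma holo_eval_zmod_morphism : zmod_morphism holo_eval.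
Proof.
by move=> x y; rewrite /holo_eval rmorphB mero_valB //; exact: holo_defined.
Qed.

Lemma holo_eval_monoid_morphism : monoid_morphism holo_eval.
Proof.
split; first by rewrite /holo_eval rmorph1 mero_val1.
by move=> x y; rewrite /holo_eval rmorphM mero_valM //; exact: holo_defined.
Qed.

HB.instance Definition _ :=
  GRing.isZmodMorphism.Build holo (Cplx R) holo_eval holo_eval_zmod_morphism.
HB.instance Definition _ :=
  GRing.isMonoidMorphism.Build holo (Cplx R) holo_eval holo_eval_monoid_morphism.

Definition to_holo (g : mero D) : holo := insubd 0 g.

Lemma to_holoK g : defined_at g z -> val (to_holo g) = g.
Proof. by move=> gz; apply: insubdK; apply/asboolP. Qed.

End HoloRing.

Lemma map_ppoly (F G : comNzRingType) (phi : {rmorphism F -> G}) n (f : F)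
    (Z : 'M[F]_n.+1) (a : {poly F}) : injective phi ->
  map_mx phi (ppoly f Z a) = ppoly (phi f) (map_mx phi Z) (map_poly phi a).
Proof.
move=> phi_inj; rewrite /ppoly size_map_inj_poly ?rmorph0 // raddf_sum.
apply: eq_bigr => k _; rewrite /= map_mxZ coef_map; congr (_ *: _).
rewrite raddf_sum; apply: eq_bigr => i _.
by rewrite /= map_mxZ !rmorphXn.
Qed.

Section Evaluation.
Variables (R : realType) (D : domain (Cplx R)) (n s : nat).
Local Notation K := (Cplx R).
Variables (A : 'M[mero D]_n.+1) (B : 'M[mero D]_(n.+1, s.+1)).
Variables (C : 'M[mero D]_(s.+1, n.+1)) (E : 'M[mero D]_s.+1).
Variables (X Y : 'M[mero D]_n.+1) (f : mero D) (a : {poly mero D}).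
Hypothesis regY : \det Y != 0.
Hypothesis aZ0 : horner_mx (f%:M - X *m A *m Y) a = 0.

Let M := block_mx A B C E.
Let P := Y *m ppoly f (f%:M - X *m A *m Y) a *m X.
Let S := a.[f] *: E - C *m P *m B.

Variable z : K.
Hypothesis Dz : domain_set D z.
Hypothesis zP : ~ pole_set f M X Y a z.

Definition val_mx p q (Z : 'M[mero D]_(p, q)) : 'M[K]_(p, q) :=
  map_mx (fun g => mero_val g z) Z.

Let H := holo Dz.
Let T : mero D -> H := @to_holo R D z Dz.
Let ev : {rmorphism H -> K} := @holo_eval R D z Dz.
Let vl : {rmorphism H -> mero D} := val.

Let vl_inj : injective vl. Proof. exact: val_inj. Qed.

Let val_mx_ev p q (Z : 'M[H]_(p, q)) : val_mx (map_mx vl Z) = map_mx ev Z.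
Proof. by apply/matrixP => i j; rewrite !mxE. Qed.

Let TK p q (Z : 'M[mero D]_(p, q)) : (forall i j, defined_at (Z i j) z) ->
  map_mx vl (map_mx T Z) = Z.
Proof. by move=> dZ; apply/matrixP => i j; rewrite !mxE; exact: to_holoK. Qed.

Let defined_mx p q (Z : 'M[mero D]_(p, q)) :
  ~ (exists i j, ~ defined_at (Z i j) z) -> forall i j, defined_at (Z i j) z.
Proof. by move=> nZ i j; apply: contrapT => nd; apply: nZ; exists i, j. Qed.

Let defM i j : defined_at (M i j) z.
Proof. by apply: defined_mx => h; apply: zP; split => //; exact: Or42. Qed.

Let vX : map_mx vl (map_mx T X) = X.
Proof.
by apply: TK; apply: defined_mx => h; apply: zP; split=> //; apply: Or43; left.
Qed.

Let vY : map_mx vl (map_mx T Y) = Y.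
Proof.
by apply: TK; apply: defined_mx => h; apply: zP; split=> //; apply: Or43; right.
Qed.

Let vA : map_mx vl (map_mx T A) = A.
Proof. by apply: TK => i j; rewrite -(block_mxEul A B C E); exact: defM. Qed.
Let vB : map_mx vl (map_mx T B) = B.
Proof. by apply: TK => i j; rewrite -(block_mxEur A B C E); exact: defM. Qed.
Let vC : map_mx vl (map_mx T C) = C.
Proof. by apply: TK => i j; rewrite -(block_mxEdl A B C E); exact: defM. Qed.
Let vE : map_mx vl (map_mx T E) = E.
Proof. by apply: TK => i j; rewrite -(block_mxEdr A B C E); exact: defM. Qed.

Let vf : vl (T f) = f.
Proof.
by apply: to_holoK; apply: contrapT => h; apply: zP; split => //; exact: Or41.
Qed.

Let a' : {poly H} := \poly_(i < size a) T a`_i.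

Let va : map_poly vl a' = a.
Proof.
apply/polyP => i; rewrite coef_map coef_poly; case: ltnP => [_|ai].
  apply: to_holoK; apply: contrapT => h; apply: zP; split => //.
  by apply: Or44; exists i.
by rewrite [RHS]nth_default //; exact: (rmorph0 vl).
Qed.

Let Z' := (T f)%:M - map_mx T X *m map_mx T A *m map_mx T Y.
Let P' := map_mx T Y *m ppoly (T f) Z' a' *m map_mx T X.

Let vZ : map_mx vl Z' = f%:M - X *m A *m Y.
Proof. by rewrite map_mxB map_scalar_mx !map_mxM vX vA vY vf. Qed.

Let vP : map_mx vl P' = P.
Proof. by rewrite !map_mxM map_ppoly // vX vY vZ va vf. Qed.

Let vaf : vl a'.[T f] = a.[f].
Proof. by rewrite -horner_map va vf. Qed.

Let aZ0' : horner_mx Z' a' = 0.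
Proof.
have e : map_mx vl (horner_mx Z' a') = 0 by rewrite map_horner_mx vZ va.
apply/matrixP => i j; apply: vl_inj.
have := congr1 (fun Z0 : 'M[mero D]_n.+1 => Z0 i j) e.
by rewrite !mxE => ->; rewrite rmorph0.
Qed.

Let PAY : (P' *m map_mx T A - a'.[T f]%:M) *m map_mx T Y = 0.
Proof.
have e := ppoly_mul (T f) Z' a'.
have fZ : (T f)%:M - Z' = map_mx T X *m map_mx T A *m map_mx T Y.
  by rewrite /Z' opprB addrC subrK.
rewrite fZ aZ0' subr0 -!mulmxA in e.
rewrite mulmxBl /P' -!mulmxA.
by rewrite e mul_mx_scalar mul_scalar_mx subrr.
Qed.

Let PA : map_mx ev P' *m map_mx ev (map_mx T A) = (ev a'.[T f])%:M.
Proof.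
rewrite -map_mxM -map_scalar_mx; apply/eqP; rewrite -subr_eq0 -map_mxB.
apply/eqP/matrixP => i j; rewrite !mxE /=.
have e : (P' *m map_mx T A - a'.[T f]%:M) *m (\det (map_mx T Y))%:M = 0.
  by rewrite -mul_mx_adj mulmxA PAY mul0mx.
apply: (mero_val_mul_eq0 Dz regY); first exact: holo_defined.
have -> : \det Y = vl (\det (map_mx T Y)) by rewrite -det_map_mx vY.
rewrite -[X in X * _]/(vl _) -rmorphM -[RHS](rmorph0 vl); congr (vl _).
by move/matrixP/(_ i j): e; rewrite mul_mx_scalar !mxE mulrC.
Qed.

Lemma evaluation_schur :
  exists (A0 P0 : 'M[K]_n.+1) B0 C0 (E0 : 'M[K]_s.+1),
  let al := mero_val a.[f] z in
  [/\ P0 *m A0 = al%:M,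
      mero_val (\det M) z = \det (block_mx A0 B0 C0 E0),
      mero_val (\det A) z = \det A0,
      val_mx M = block_mx A0 B0 C0 E0 &
      val_mx S = al *: E0 - C0 *m P0 *m B0].
Proof.
have alE : mero_val a.[f] z = ev a'.[T f] by rewrite -vaf.
have ME : M = map_mx vl (block_mx (map_mx T A) (map_mx T B) (map_mx T C) (map_mx T E)).
  by rewrite map_block_mx vA vB vC vE.
have SE : S = map_mx vl (a'.[T f] *: map_mx T E - map_mx T C *m P' *m map_mx T B).
  by rewrite map_mxB map_mxZ map_mxM [X in _ - X *m _]map_mxM vP vC vB vE vaf.
exists (map_mx ev (map_mx T A)), (map_mx ev P'), (map_mx ev (map_mx T B)),
  (map_mx ev (map_mx T C)), (map_mx ev (map_mx T E)) => al; rewrite /al alE.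
split.
- exact: PA.
- by rewrite -map_block_mx det_map_mx ME det_map_mx.
- by rewrite -[A in LHS]vA !det_map_mx.
- by rewrite ME val_mx_ev map_block_mx.
- by rewrite SE val_mx_ev map_mxB map_mxZ map_mxM [X in _ - X *m _]map_mxM.
Qed.

End Evaluation.

Lemma gershgorinP (R : realType) (D : domain (Cplx R)) (W : set (Cplx R)) m
    (Z : 'M[mero D]_m) z : W z ->
  gershgorin W Z z <-> gersh_cond (val_mx z Z).
Proof.
move=> Wz; split=> [[_ [i h]]|[i h]]; [|split => //]; exists i.
  by rewrite /radius mxE; under eq_bigr do rewrite mxE.
by move: h; rewrite /radius mxE; under eq_bigr do rewrite mxE.
Qed.

Lemma brauerP (R : realType) (D : domain (Cplx R)) (W : set (Cplx R)) m
    (Z : 'M[mero D]_m) z : W z ->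
  brauer W Z z <-> brauer_cond (val_mx z Z).
Proof.
have rE i : radius (val_mx z Z) i = \sum_(j < m | j != i) `|mero_val (Z i j) z|.
  by rewrite /radius; under eq_bigr do rewrite mxE.
move=> Wz; split=> [[_ [i [k [ik h]]]]|[i [k [ik h]]]]; [|split => //];
  exists i, k; split => //.
  by rewrite !mxE !rE.
by move: h; rewrite !mxE !rE.
Qed.

Theorem theorem3 (R : realType) (D : domain (Cplx R)) (n s : nat)
    (A : 'M[mero D]_n.+1) (B : 'M[mero D]_(n.+1, s.+1))
    (C : 'M[mero D]_(s.+1, n.+1)) (E : 'M[mero D]_s.+1)
    (X Y : 'M[mero D]_n.+1) (f : mero D) (a : {poly mero D})
    (regX : \det X != 0) (regY : \det Y != 0) (a_neq0 : a != 0)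
    (aZ0 : horner_mx (f%:M - X *m A *m Y) a = 0) :
  let M : 'M[mero D]_(n.+1 + s.+1) := block_mx A B C E in
  let DP : set (Cplx R) := domain_set D `\` pole_set f M X Y a in
  let P : 'M[mero D]_n.+1 := Y *m ppoly f (f%:M - X *m A *m Y) a *m X in
  let S : 'M[mero D]_s.+1 := a.[f] *: E - C *m P *m B in
  let rho := zero_set DP in
  (rho (\det M) `<=` gershgorin DP S `|` rho (\det A) /\
   gershgorin DP S `|` rho (\det A) `<=` gershgorin DP M `|` rho a.[f]) /\
  (((1 < s.+1)%N -> rho (\det M) `<=` brauer DP S `|` rho (\det A)) /\
   brauer DP S `|` rho (\det A) `<=` brauer DP M `|` rho a.[f]).
Proof.
move=> M DP P S rho.
have evz z : DP z -> _ := fun '(conj Dz zP) =>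
  evaluation_schur regY aZ0 Dz zP.
split; split=> [|z].
- move=> z [Wz dM]; have [A0 [P0 [B0 [C0 [E0 [PA dME dAE _ SE]]]]]] := evz z Wz.
  have [dA|dA] := eqVneq (mero_val (\det A) z) 0; [by right | left].
  apply/(gershgorinP _ Wz); rewrite SE; apply: gershgorin_singular.
  by apply: (det_schur PA); rewrite -?dME -?dAE.
- have [Wz|nWz] := pselect (DP z); last by case=> -[].
  have [A0 [P0 [B0 [C0 [E0 [PA dME dAE ME SE]]]]]] := evz z Wz.
  have [al0|al0] := eqVneq (mero_val a.[f] z) 0; first by move=> _; right.
  case=> [|[_]]; last by rewrite dAE => /eqP; rewrite (negbTE (schur_detA PA al0)).
  move=> /(gershgorinP _ Wz); rewrite SE => /(gersh_schur PA al0); rewrite -ME => h.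
  by left; apply/(gershgorinP _ Wz).
- move=> s1 z [Wz dM]; have [A0 [P0 [B0 [C0 [E0 [PA dME dAE _ SE]]]]]] := evz z Wz.
  have [dA|dA] := eqVneq (mero_val (\det A) z) 0; [by right | left].
  apply/(brauerP _ Wz); rewrite SE.
  have : \det (mero_val a.[f] z *: E0 - C0 *m P0 *m B0) = 0.
    by apply: (det_schur PA); rewrite -?dME -?dAE.
  by case: (s) s1 E0 C0 B0 {PA dME dAE SE} => // m _ E0 C0 B0; exact: brauer_singular.
- have [Wz|nWz] := pselect (DP z); last by case=> -[].
  have [A0 [P0 [B0 [C0 [E0 [PA dME dAE ME SE]]]]]] := evz z Wz.
  have [al0|al0] := eqVneq (mero_val a.[f] z) 0; first by move=> _; right.
  case=> [|[_]]; last by rewrite dAE => /eqP; rewrite (negbTE (schur_detA PA al0)).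
  move=> /(brauerP _ Wz); rewrite SE => /(brauer_schur PA al0); rewrite -ME => h.
  by left; apply/(brauerP _ Wz).
Qed.
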